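(* Let $\mathbb K$ be an algebraically closed field of characteristic $2$. For the Lie algebra $\mathfrak g=\mathfrak e(8)$, we have $H^1(\mathfrak g;\mathfrak g)=0$ and $H^2(\mathfrak g)=0$. For the Lie superalgebras $\mathfrak g=\mathfrak e(8,1)$ and $\mathfrak g=\mathfrak e(8,8)$, we have $H^1(\mathfrak g;\mathfrak g)=0$, whereas $$H^2(\mathfrak g)=\operatorname{Span}\big(\widehat x_i\wedge\widehat x_i,\ \widehat y_i\wedge\widehat y_i\ \text{ for all } i \text{ such that } x_i \text{ and } y_i \text{ are odd}\big)$$ (the span of cohomology classes).
   Context: $\mathfrak e(8)=\mathfrak g(A)$, where $A$ is the Cartan matrix of type $E_8$ reduced modulo $2$ (zero diagonal, entries $1$ for adjacent nodes), with nodes numbered so that $1-2-3-4-5-6-7$ is a chain and node $8$ is attached to node $5$. $\mathfrak e(8,i)$ is the Lie superalgebra $\mathfrak g(A)$ with the same matrix $A$ in which the only odd Chevalley generators are $x_i$ and $y_i$. Here, for an invertible matrix $A$ and parities $p_j$, $\mathfrak g(A)$ is the quotient of the Lie superalgebra generated by even $h_j$ and $x_j,y_j$ of parity $p_j$ with relations $[h_i,h_j]=0$, $[h_i,x_j]=A_{ij}x_j$, $[h_i,y_j]=-A_{ij}y_j$, $[x_i,y_j]=\delta_{ij}h_i$ by the largest ideal graded with respect to $\deg x_i=e_i=-\deg y_i$ and intersecting $\operatorname{Span}(h_i)$ trivially. In the formula for $H^2$, $x_i$ (resp. $y_i$) runs over a basis of positive (resp. negative) root vectors, hats denote dual basis elements.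 A Lie superalgebra in characteristic $2$ has a squaring $x\mapsto x^2$, $\mathfrak g_{\bar1}\to\mathfrak g_{\bar0}$, with $(ax)^2=a^2x^2$, $[x,y]=(x+y)^2-x^2-y^2$ on $\mathfrak g_{\bar1}$, $[x^2,y]=[x,[x,y]]$. $H^1(\mathfrak g;\mathfrak g)$ is the superspace of derivations (also satisfying $D(x^2)=[Dx,x]$ for odd $x$) modulo inner ones. $H^2(\mathfrak g)$ (trivial coefficients, both parities): a 2-cocycle is a pair $(c,q)$, $c$ an alternating bilinear form on $\mathfrak g$, $q$ a quadratic form on $\mathfrak g_{\bar1}$ with polar form $c|_{\mathfrak g_{\bar1}}$, such that $c([x,y],z)+c([y,z],x)+c([z,x],y)=0$ and $c(x^2,y)=c(x,[x,y])$ for odd $x$ and all $y$; coboundaries are $c(x,y)=f([x,y])$, $q(x)=f(x^2)$; $\alpha\wedge\alpha$ denotes the pair $c=0$, $q=\alpha^2$. For Lie algebras this is the usual Chevalley--Eilenberg cohomology. *)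

(* Defs.v *)
From HB Require Import structures.
From mathcomp Require Import all_boot all_order all_algebra generic_quotient.
From mathcomp Require Import boolp functions.

Set Implicit Arguments.
Unset Strict Implicit.
Unset Printing Implicit Defensive.

Import GRing.Theory.
Local Open Scope ring_scope.
Local Open Scope quotient_scope.

(* Lie superalgebras over a field of characteristic 2.  The superspace
   structure is the projection [od] onto the odd component along the even one,
   and the squaring is extended to the whole space by
   [sq v = (od v)^2], so that all axioms are equations. *)
Record is_lieSuper (K : fieldType) (V : lmodType K)
    (od : V -> V) (br : V -> V -> V) (sq : V -> V) : Prop := IsLieSuper {
  od_linear : linear od;
  od_idem : forall u, od (od u) = od u;
  br_linearl : forall w, linear (br^~ w);
  br_linearr : forall w, linear (br w);
  br_alt : forall u, br u u = 0;
  br_jacobi : forall u v w, br u (br v w) + br v (br w u) + br w (br u v) = 0;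
  (* [g_p, g_q] is contained in g_{p+q} *)
  od_br : forall u v, od (br u v) = br (od u) (v - od v) + br (u - od u) (od v);
  sq_od : forall u, sq (od u) = sq u;
  od_sq : forall u, od (sq u) = 0;
  sq_scale : forall a u, sq (a *: u) = a ^+ 2 *: sq u;
  sq_polar : forall u v, br (od u) (od v) = sq (u + v) - sq u - sq v;
  br_sq : forall u v, br (sq u) v = br (od u) (br (od u) v) }.

Record lieSuper (K : fieldType) := LieSuper {
  lie_sort :> lmodType K;
  od : lie_sort -> lie_sort;
  br : lie_sort -> lie_sort -> lie_sort;
  sq : lie_sort -> lie_sort;
  lieP : is_lieSuper od br sq }.

Definition has_parity (K : fieldType) (L : lieSuper K) (b : bool) (v : L) :=
  od v = if b then v else 0.

Definition is_odd (K : fieldType) (L : lieSuper K) (v : L) := has_parity true v.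

Section BasicLie.
Variables (K : fieldType) (L : lieSuper K).
Implicit Types u v w : L.

Lemma odD u v : od (u + v) = od u + od v.
Proof. by rewrite -[u in LHS]scale1r (od_linear (lieP L)) scale1r. Qed.

Lemma od0 : od (0 : L) = 0.
Proof. by apply: (addrI (od (0 : L))); rewrite -odD !addr0. Qed.

Lemma odZ a u : od (a *: u) = a *: od u.
Proof. by rewrite -[a *: u]addr0 (od_linear (lieP L)) od0 addr0. Qed.

Lemma brDl u v w : br (u + v) w = br u w + br v w.
Proof.
by rewrite -[u in LHS]scale1r; have /= -> := br_linearl (lieP L) w 1 u v; rewrite scale1r.
Qed.

Lemma br0l w : br (0 : L) w = 0.
Proof. by apply: (addrI (br (0 : L) w)); rewrite -brDl !addr0. Qed.

Lemma brZl a u w : br (a *: u) w = a *: br u w.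
Proof.
by rewrite -[a *: u]addr0; have /= -> := br_linearl (lieP L) w a u 0; rewrite br0l addr0.
Qed.

Lemma brDr w u v : br w (u + v) = br w u + br w v.
Proof. by rewrite -[u in LHS]scale1r (br_linearr (lieP L)) scale1r. Qed.

Lemma br0r w : br w (0 : L) = 0.
Proof. by apply: (addrI (br w (0 : L))); rewrite -brDr !addr0. Qed.

Lemma brZr a u w : br w (a *: u) = a *: br w u.
Proof. by rewrite -[a *: u]addr0 (br_linearr (lieP L)) br0r addr0. Qed.

Lemma brNl u w : br (- u) w = - br u w.
Proof. by rewrite -scaleN1r brZl scaleN1r. Qed.

Lemma brNr w u : br w (- u) = - br w u.
Proof. by rewrite -scaleN1r brZr scaleN1r. Qed.

Lemma odN u : od (- u) = - od u.
Proof. by rewrite -scaleN1r odZ scaleN1r. Qed.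

Lemma brC u v : br u v = - br v u.
Proof.
apply/eqP; rewrite -addr_eq0; apply/eqP.
have := br_alt (lieP L) (u + v).
by rewrite brDl !brDr !(br_alt (lieP L)) add0r addr0.
Qed.

Lemma sqD u v : sq (u + v) = sq u + sq v + br (od u) (od v).
Proof. by rewrite (sq_polar (lieP L)) -(addrA (sq (u + v))) -opprD [RHS]addrC subrK. Qed.

End BasicLie.

Section Ideals.
Variables (K : fieldType) (L : lieSuper K).

Record lie_ideal (I : L -> Prop) : Prop := LieIdeal {
  ideal0 : I 0;
  idealD : forall u v, I u -> I v -> I (u + v);
  idealZ : forall a u, I u -> I (a *: u);
  ideal_od : forall u, I u -> I (od u);
  ideal_br : forall u v, I v -> I (br u v);
  ideal_sq : forall u, I u -> I (sq u) }.

Definition congruent (I : L -> Prop) (u v : L) : bool := `[< I (v - u) >].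

End Ideals.

Section QuotientAlgebra.
Variables (K : fieldType) (L : lieSuper K) (I : L -> Prop) (idI : lie_ideal I).

Lemma idealN u : I u -> I (- u).
Proof. by move=> Iu; rewrite -scaleN1r; apply: (idealZ idI). Qed.

Lemma congruent_refl : reflexive (congruent I).
Proof. by move=> u; apply/asboolP; rewrite subrr; apply: (ideal0 idI). Qed.

Lemma congruent_sym : symmetric (congruent I).
Proof.
by move=> u v; apply/asboolP/asboolP => /idealN; rewrite opprB.
Qed.

Lemma congruent_trans : transitive (congruent I).
Proof.
move=> v u w /asboolP Iuv /asboolP Ivw; apply/asboolP.
by rewrite -(subrK v w) -addrA; apply: (idealD idI).
Qed.

Definition congruent_equiv : equiv_rel L :=
  EquivRel (congruent I) congruent_refl congruent_sym congruent_trans.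

(* The proof that I is an ideal is a parameter of the type: the canonical
   instances below depend on it. *)
Definition quot_of of lie_ideal I := {eq_quot congruent_equiv}.
Local Notation Q := (quot_of idI).
HB.instance Definition _ := Choice.on Q.

Definition to_quot (u : L) : Q := \pi_({eq_quot congruent_equiv}) u.
Definition of_quot (q : Q) : L := repr (q : {eq_quot congruent_equiv}).

Lemma of_quotK q : to_quot (of_quot q) = q.
Proof. exact: reprK. Qed.

Lemma to_quotP u v : to_quot u = to_quot v <-> I (v - u).
Proof.
split=> [/eqquotP /asboolP //|Iuv]; apply/eqquotP; exact/asboolP.
Qed.

Lemma of_quotP u : I (u - of_quot (to_quot u)).
Proof. by apply/to_quotP; rewrite of_quotK. Qed.

(* Locked: otherwise sums and multiples in Q unify with [to_quot _]. *)
Fact quot_key : unit. Proof. exact: tt. Qed.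
Definition qadd (p q : Q) := locked_with quot_key (to_quot (of_quot p + of_quot q)).
Definition qopp (p : Q) := locked_with quot_key (to_quot (- of_quot p)).
Definition qscale (a : K) (p : Q) := locked_with quot_key (to_quot (a *: of_quot p)).
Definition qod (p : Q) := locked_with quot_key (to_quot (od (of_quot p))).
Definition qbr (p q : Q) := locked_with quot_key (to_quot (br (of_quot p) (of_quot q))).
Definition qsq (p : Q) := locked_with quot_key (to_quot (sq (of_quot p))).

Lemma qaddE u v : qadd (to_quot u) (to_quot v) = to_quot (u + v).
Proof.
rewrite /qadd unlock; apply/to_quotP; rewrite opprD addrACA.
by apply: (idealD idI); apply: of_quotP.
Qed.

Lemma qoppE u : qopp (to_quot u) = to_quot (- u).
Proof. by rewrite /qopp unlock; apply/to_quotP; rewrite -opprD; apply/idealN/of_quotP. Qed.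

Lemma qscaleE a u : qscale a (to_quot u) = to_quot (a *: u).
Proof.
by rewrite /qscale unlock; apply/to_quotP; rewrite -scalerBr; apply/(idealZ idI)/of_quotP.
Qed.

Lemma qodE u : qod (to_quot u) = to_quot (od u).
Proof.
rewrite /qod unlock; apply/to_quotP; rewrite -odN -odD.
exact/(ideal_od idI)/of_quotP.
Qed.

Lemma qbrE u v : qbr (to_quot u) (to_quot v) = to_quot (br u v).
Proof.
rewrite /qbr unlock; apply/to_quotP; set u' := of_quot _; set v' := of_quot _.
have -> : br u v - br u' v' = - br v (u - u') + br u' (v - v').
  by rewrite -(brC (u - u')) brDl brDr brNl brNr addrA subrK.
apply: (idealD idI); first apply: idealN.
all: by apply/(ideal_br idI)/of_quotP.
Qed.

Lemma qsqE u : qsq (to_quot u) = to_quot (sq u).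
Proof.
rewrite /qsq unlock; apply/to_quotP; set u' := of_quot _.
rewrite -[u in sq u](subrK u') sqD addrAC addrK brC.
have Iu : I (u - u') by apply: of_quotP.
apply: (idealD idI); first exact: (ideal_sq idI).
by rewrite -brC brC; apply/idealN/(ideal_br idI)/(ideal_od idI).
Qed.

Lemma qind (P : Q -> Prop) : (forall u, P (to_quot u)) -> forall q, P q.
Proof. by move=> Pto q; rewrite -(of_quotK q). Qed.

Lemma qaddA : associative qadd.
Proof.
by elim/qind=> u; elim/qind=> v; elim/qind=> w; rewrite !qaddE addrA.
Qed.

Lemma qaddC : commutative qadd.
Proof. by elim/qind=> u; elim/qind=> v; rewrite !qaddE addrC. Qed.

Lemma qadd0 : left_id (to_quot 0) qadd.
Proof. by elim/qind=> u; rewrite qaddE add0r. Qed.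

Lemma qaddN : left_inverse (to_quot 0) qopp qadd.
Proof. by elim/qind=> u; rewrite qoppE qaddE addNr. Qed.

HB.instance Definition _ := GRing.isZmodule.Build Q qaddA qaddC qadd0 qaddN.

Lemma qscaleA a b p : qscale a (qscale b p) = qscale (a * b) p.
Proof. by elim/qind: p => u; rewrite !qscaleE scalerA. Qed.

Lemma qscale1 : left_id 1 qscale.
Proof. by elim/qind=> u; rewrite qscaleE scale1r. Qed.

Lemma qscaleDr : right_distributive qscale +%R.
Proof.
move=> a; elim/qind=> u; elim/qind=> v.
by rewrite /GRing.add /= qaddE !qscaleE qaddE scalerDr.
Qed.

Lemma qscaleDl p : {morph qscale^~ p : a b / a + b}.
Proof.
move=> a b; elim/qind: p => u.
by rewrite {2}/GRing.add /= !qscaleE qaddE scalerDl.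
Qed.

HB.instance Definition _ :=
  GRing.Zmodule_isLmodule.Build K Q qscaleA qscale1 qscaleDr qscaleDl.

Lemma to_quotD u v : to_quot (u + v) = to_quot u + to_quot v.
Proof. by rewrite [RHS]qaddE. Qed.

Lemma to_quotN u : to_quot (- u) = - to_quot u.
Proof. by rewrite [RHS]qoppE. Qed.

Lemma to_quotZ a u : to_quot (a *: u) = a *: to_quot u.
Proof. by rewrite [RHS]qscaleE. Qed.

Lemma to_quot0 : to_quot 0 = 0. Proof. by []. Qed.

Let lift := (qodE, qbrE, qsqE, =^~ to_quotD, =^~ to_quotN, =^~ to_quotZ).

Lemma quot_lie : is_lieSuper qod qbr qsq.
Proof.
have [H1 H2 H3 H4 H5 H6 H7 H8 H9 H10 H11 H12] := lieP L.
split.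
- by move=> a; elim/qind=> u; elim/qind=> v; rewrite !lift H1.
- by elim/qind=> u; rewrite !lift H2.
- elim/qind=> w a; elim/qind=> u; elim/qind=> v /=; rewrite !lift.
  by rewrite brDl brZl.
- by elim/qind=> w a; elim/qind=> u; elim/qind=> v; rewrite !lift H4.
- by elim/qind=> u; rewrite !lift H5.
- by elim/qind=> u; elim/qind=> v; elim/qind=> w; rewrite !lift H6.
- by elim/qind=> u; elim/qind=> v; rewrite !lift H7.
- by elim/qind=> u; rewrite !lift H8.
- by elim/qind=> u; rewrite !lift H9.
- by move=> a; elim/qind=> u; rewrite !lift H10.
- by elim/qind=> u; elim/qind=> v; rewrite !lift H11.
- by elim/qind=> u; elim/qind=> v; rewrite !lift H12.
Qed.

Definition quot_lieSuper : lieSuper K := LieSuper quot_lie.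

End QuotientAlgebra.

Section Presented.
Variables (K : fieldType) (n : nat).

Inductive generator := H of 'I_n | X of 'I_n | Y of 'I_n.

Inductive term :=
  | tGen of generator
  | tZero
  | tAdd of term & term
  | tOpp of term
  | tScale of K & term
  | tOd of term
  | tBr of term & term
  | tSq of term.

HB.instance Definition _ := gen_eqMixin term.
HB.instance Definition _ := gen_choiceMixin term.

Fixpoint eval (L : lieSuper K) (g : generator -> L) (t : term) : L :=
  match t with
  | tGen s => g s
  | tZero => 0
  | tAdd t1 t2 => eval g t1 + eval g t2
  | tOpp t1 => - eval g t1
  | tScale a t1 => a *: eval g t1
  | tOd t1 => od (eval g t1)
  | tBr t1 t2 => br (eval g t1) (eval g t2)
  | tSq t1 => sq (eval g t1)
  end.

Variables (A : 'M[K]_n) (p : 'I_n -> bool).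

Record cartan_relations (L : lieSuper K) (g : generator -> L) : Prop := CartanRelations {
  parity_h : forall j, has_parity false (g (H j));
  parity_x : forall j, has_parity (p j) (g (X j));
  parity_y : forall j, has_parity (p j) (g (Y j));
  rel_hh : forall i j, br (g (H i)) (g (H j)) = 0;
  rel_hx : forall i j, br (g (H i)) (g (X j)) = A i j *: g (X j);
  rel_hy : forall i j, br (g (H i)) (g (Y j)) = - A i j *: g (Y j);
  rel_xy : forall i j, br (g (X i)) (g (Y j)) = if i == j then g (H i) else 0 }.

(* [t = u] is a consequence of the axioms of Lie superalgebras and of the
   relations; Lie superalgebras form a variety (all axioms are equations), so
   the quotient below is the Lie superalgebra presented by the generators
   and the relations. *)
Definition consequence (t u : term) : bool :=
  `[< forall (L : lieSuper K) (g : generator -> L),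
        cartan_relations g -> eval g t = eval g u >].

Lemma consequence_refl : reflexive consequence.
Proof. by move=> t; apply/asboolP. Qed.

Lemma consequence_sym : symmetric consequence.
Proof.
by move=> t u; apply/asboolP/asboolP => tu L g /tu ->.
Qed.

Lemma consequence_trans : transitive consequence.
Proof.
by move=> u t v /asboolP tu /asboolP uv; apply/asboolP => L g r; rewrite tu ?uv.
Qed.

Definition consequence_equiv : equiv_rel term :=
  EquivRel consequence consequence_refl consequence_sym consequence_trans.

Definition presented := {eq_quot consequence_equiv}.
HB.instance Definition _ := Choice.on presented.

Definition cls (t : term) : presented := \pi_({eq_quot consequence_equiv}) t.
Definition rep (P : presented) : term := repr (P : {eq_quot consequence_equiv}).

Lemma repK P : cls (rep P) = P.
Proof. exact: reprK. Qed.

Lemma clsP t u : cls t = cls u <->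
  forall (L : lieSuper K) (g : generator -> L),
    cartan_relations g -> eval g t = eval g u.
Proof.
by split=> [/eqquotP /asboolP //|tu]; apply/eqquotP; apply/asboolP.
Qed.

Lemma eval_rep t (L : lieSuper K) (g : generator -> L) :
  cartan_relations g -> eval g (rep (cls t)) = eval g t.
Proof. by move: L g; apply/clsP; rewrite repK. Qed.

Definition padd (P Q : presented) := cls (tAdd (rep P) (rep Q)).
Definition popp (P : presented) := cls (tOpp (rep P)).
Definition pscale (a : K) (P : presented) := cls (tScale a (rep P)).
Definition pod (P : presented) := cls (tOd (rep P)).
Definition pbr (P Q : presented) := cls (tBr (rep P) (rep Q)).
Definition psq (P : presented) := cls (tSq (rep P)).

Local Ltac peval := apply/clsP => L g r /=; repeat rewrite eval_rep //=.

Lemma paddA : associative padd.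
Proof. by move=> P Q R; peval; rewrite addrA. Qed.

Lemma paddC : commutative padd.
Proof. by move=> P Q; peval; rewrite addrC. Qed.

Lemma padd0 : left_id (cls tZero) padd.
Proof. by move=> P; rewrite -[RHS]repK; peval; rewrite add0r. Qed.

Lemma paddN : left_inverse (cls tZero) popp padd.
Proof. by move=> P; peval; rewrite addNr. Qed.

HB.instance Definition _ := GRing.isZmodule.Build presented paddA paddC padd0 paddN.

Lemma pscaleA a b P : pscale a (pscale b P) = pscale (a * b) P.
Proof. by peval; rewrite scalerA. Qed.

Lemma pscale1 : left_id 1 pscale.
Proof. by move=> P; rewrite -[RHS]repK; peval; rewrite scale1r. Qed.

Lemma pscaleDr : right_distributive pscale +%R.
Proof. by move=> a P Q; peval; rewrite scalerDr. Qed.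

Lemma pscaleDl P : {morph pscale^~ P : a b / a + b}.
Proof. by move=> a b; peval; rewrite scalerDl. Qed.

HB.instance Definition _ := GRing.Zmodule_isLmodule.Build K presented
  pscaleA pscale1 pscaleDr pscaleDl.

Lemma presented_lie : is_lieSuper pod pbr psq.
Proof.
split.
- by move=> a u v; peval; rewrite (od_linear (lieP L)).
- by move=> u; peval; rewrite (od_idem (lieP L)).
- by move=> w a u v /=; peval; rewrite brDl brZl.
- by move=> w a u v; peval; rewrite brDr brZr.
- by move=> u; peval; rewrite (br_alt (lieP L)).
- by move=> u v w; peval; rewrite (br_jacobi (lieP L)).
- by move=> u v; peval; rewrite (od_br (lieP L)).
- by move=> u; peval; rewrite (sq_od (lieP L)).
- by move=> u; peval; rewrite (od_sq (lieP L)).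
- by move=> a u; peval; rewrite (sq_scale (lieP L)).
- by move=> u v; peval; rewrite (sq_polar (lieP L)).
- by move=> u v; peval; rewrite (br_sq (lieP L)).
Qed.

Definition gtilde : lieSuper K := LieSuper presented_lie.
Definition gtilde_gen (s : generator) : gtilde := cls (tGen s).

Lemma gtilde_relations : cartan_relations gtilde_gen.
Proof.
split=> [j|j|j|i j|i j|i j|i j]; rewrite /has_parity.
- by peval; rewrite (parity_h r).
- have := fun (L : lieSuper K) (g : generator -> L) (r : cartan_relations g) => parity_x r j.
  by rewrite /has_parity; case: (p j) => par; peval; rewrite par.
- have := fun (L : lieSuper K) (g : generator -> L) (r : cartan_relations g) => parity_y r j.
  by rewrite /has_parity; case: (p j) => par; peval; rewrite par.
- by peval; rewrite (rel_hh r).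
- by peval; rewrite (rel_hx r).
- by peval; rewrite (rel_hy r).
- have := fun (L : lieSuper K) (g : generator -> L) (r : cartan_relations g) => rel_xy r i j.
  by case: (i == j) => rel; peval; rewrite rel.
Qed.

End Presented.

Arguments H {n}.
Arguments X {n}.
Arguments Y {n}.

Section Contragredient.
Variables (K : fieldType) (n : nat).

Section Grading.
Variables (L : lieSuper K) (g : generator n -> L).

(* [homogeneous d v]: v belongs to the component of degree d, where
   deg x_i = e_i = - deg y_i and deg h_i = 0. *)
Inductive homogeneous : 'rV[int]_n -> L -> Prop :=
  | hom_h j : homogeneous 0 (g (H j))
  | hom_x j : homogeneous (delta_mx 0 j) (g (X j))
  | hom_y j : homogeneous (- delta_mx 0 j) (g (Y j))
  | hom_0 d : homogeneous d 0
  | hom_add d u v : homogeneous d u -> homogeneous d v -> homogeneous d (u + v)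
  | hom_scale d a u : homogeneous d u -> homogeneous d (a *: u)
  | hom_br d e u v : homogeneous d u -> homogeneous e v ->
      homogeneous (d + e) (br u v)
  | hom_sq d u : homogeneous d u -> homogeneous (d *+ 2) (sq u).

Definition graded (J : L -> Prop) : Prop :=
  forall v, J v -> exists s : seq L,
    v = \sum_(w <- s) w /\
    forall w, w \in s -> J w /\ exists d, homogeneous d w.

Definition span_h (v : L) : Prop := exists a : 'I_n -> K, v = \sum_j a j *: g (H j).

(* The sum of all graded ideals meeting Span(h_j) trivially, as the least
   ideal containing them all. *)
Definition max_ideal (v : L) : Prop :=
  forall I : L -> Prop, lie_ideal I ->
    (forall J : L -> Prop, lie_ideal J -> graded J ->
       (forall u, J u -> span_h u -> u = 0) -> forall u, J u -> I u) ->
    I v.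

Lemma max_ideal_ideal : lie_ideal max_ideal.
Proof.
split=> [|u v mu mv|a u mu|u mu|u v mv|u mu] I idI JI.
- exact: (ideal0 idI).
- by apply: (idealD idI); [apply: mu | apply: mv].
- by apply: (idealZ idI); apply: mu.
- by apply: (ideal_od idI); apply: mu.
- by apply: (ideal_br idI); apply: mv.
- by apply: (ideal_sq idI); apply: mu.
Qed.

End Grading.

Variables (A : 'M[K]_n) (p : 'I_n -> bool).

Definition contragredient : lieSuper K :=
  quot_lieSuper (max_ideal_ideal (@gtilde_gen K n A p)).

Definition chevalley (s : generator n) : contragredient :=
  to_quot (max_ideal_ideal (@gtilde_gen K n A p)) (gtilde_gen A p s).

Lemma contragredient_even : (forall j, ~~ p j) ->
  forall v : contragredient, od v = 0.
Proof.
move=> p0 v; rewrite -[v]of_quotK; move: (of_quot v) => t.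
have -> : @od K contragredient (to_quot _ t) = to_quot _ (od t) by rewrite -qodE.
suff -> : od t = 0 by [].
rewrite -[t]repK; apply/clsP => L g r /=; rewrite !eval_rep //.
move: (rep t); elim=> [[] j||t1 h1 t2 h2|t1 h1|a t1 h1|t1 h1|t1 h1 t2 h2|t1 h1] //=.
- exact: (parity_h r).
- by rewrite (parity_x r) (negPf (p0 j)).
- by rewrite (parity_y r) (negPf (p0 j)).
- exact: od0.
- by rewrite odD h1 h2 addr0.
- by rewrite odN h1 oppr0.
- by rewrite odZ h1 scaler0.
- by rewrite (od_idem (lieP L)) h1.
- by rewrite (od_br (lieP L)) h1 h2 br0l br0r addr0.
- exact: (od_sq (lieP L)).
Qed.

End Contragredient.

Section Cohomology.
Variables (K : fieldType) (L : lieSuper K).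

Definition derivation (D : L -> L) : Prop :=
  [/\ linear D,
      forall u v, D (br u v) = br (D u) v + br u (D v)
    & forall u, is_odd u -> D (sq u) = br (D u) u].

Definition inner_derivation (D : L -> L) : Prop := exists z, D = br z.

(* H^1(L; L) = 0; derivations of both parities and their sums are included. *)
Definition H1_zero : Prop := forall D, derivation D -> inner_derivation D.

(* Pairs (c, q).  As for [sq], the quadratic form q on the odd part is
   extended to L through the projection [od]. *)
Definition cochain2 := ((L -> L -> K^o) * (L -> K^o))%type.

Definition cocycle2 (z : cochain2) : Prop :=
  let c := z.1 in let q := z.2 in
  [/\ (forall v, scalar (c v)) /\ (forall v, scalar (c^~ v)),
      forall u, c u u = 0,
      [/\ forall u, q (od u) = q u,
          forall a u, q (a *: u) = a ^+ 2 * q u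
        & forall u v, is_odd u -> is_odd v -> q (u + v) - q u - q v = c u v],
      forall u v w, c (br u v) w + c (br v w) u + c (br w u) v = 0
    & forall u v, is_odd u -> c (sq u) v = c u (br u v)].

Definition coboundary2 (z : cochain2) : Prop :=
  exists f : {scalar L}, z = (fun u v => f (br u v), fun u => f (sq u)).

(* H^2(L) = 0 *)
Definition H2_zero : Prop := forall z, cocycle2 z <-> coboundary2 z.

Definition in_span (S : cochain2 -> Prop) (z : cochain2) : Prop :=
  exists m (a : 'I_m -> K) (w : 'I_m -> cochain2),
    (forall k, S (w k)) /\ z = \sum_k a k *: w k.

(* H^2(L) is the span of the classes of the elements of S: as subspaces of the
   space of cochains, Z^2 = Span(S) + B^2. *)
Definition H2_is_span (S : cochain2 -> Prop) : Prop :=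
  forall z, cocycle2 z <->
    exists s b, [/\ in_span S s, coboundary2 b & z = s + b].

(* alpha /\ alpha *)
Definition wedge_square (alpha : L -> K) : cochain2 :=
  (fun _ _ => 0, fun u => alpha (od u) ^+ 2).

End Cohomology.

Section RootBasis.
Variables (K : fieldType) (n : nat) (L : lieSuper K) (g : generator n -> L).

Definition dual_bases (B : eqType) (b : B -> L) (hat : B -> {scalar L}) : Prop :=
  (forall i j, hat i (b j) = (i == j)%:R) /\
  (forall v, exists (s : seq B) (a : B -> K), v = \sum_(i <- s) a i *: b i).

(* A basis of L consisting of the h_j, of positive root vectors x_i and
   of root vectors y_i of opposite degrees, with its dual basis. *)
Definition root_basis (I : eqType) (x y : I -> L)
    (hath : 'I_n -> {scalar L}) (hatx haty : I -> {scalar L}) : Prop :=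
  (exists d : I -> 'rV[int]_n, forall i,
     [/\ d i != 0, forall j, 0 <= d i 0 j,
         homogeneous g (d i) (x i) & homogeneous g (- d i) (y i)]) /\
  dual_bases
    (fun k : ('I_n + (I + I))%type =>
       match k with inl j => g (H j) | inr (inl i) => x i | inr (inr i) => y i end)
    (fun k => match k with
       inl j => hath j | inr (inl i) => hatx i | inr (inr i) => haty i end).

Definition odd_root_squares (I : eqType) (x y : I -> L)
    (hatx haty : I -> {scalar L}) (w : cochain2 L) : Prop :=
  exists i, [/\ is_odd (x i), is_odd (y i)
    & w = wedge_square (hatx i) \/ w = wedge_square (haty i)].

End RootBasis.

(* Nodes are numbered from 1, as in the Dynkin diagram. *)
Definition E8_edge (a b : nat) : bool :=
  (a, b) \in [:: (1, 2); (2, 3); (3, 4); (4, 5); (5, 6); (6, 7); (5, 8)]%N.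

Definition cartan_E8 (K : fieldType) : 'M[K]_8 :=
  \matrix_(i, j) (E8_edge i.+1 j.+1 || E8_edge j.+1 i.+1)%:R.

Definition e8 (K : fieldType) : lieSuper K :=
  contragredient (cartan_E8 K) (fun _ => false).

(* e(8, i): x_i and y_i are the only odd Chevalley generators. *)
Definition e8super (K : fieldType) (i : nat) : lieSuper K :=
  contragredient (cartan_E8 K) (fun j => j.+1 == i).

Definition e8super_gen (K : fieldType) (i : nat) : generator 8 -> e8super K i :=
  @chevalley K 8 (cartan_E8 K) (fun j => j.+1 == i).

(* e(8) is purely even: it is a Lie algebra, and cochains on it have no
   quadratic component. *)
Lemma e8_even (K : fieldType) (v : e8 K) : od v = 0.
Proof. exact: contragredient_even. Qed.

(* Main.v *)
Require Import Defs.
From HB Require Import structures.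
From mathcomp Require Import all_boot all_order all_algebra.
From mathcomp Require Import boolp functions zify ring.
Set Implicit Arguments.
Unset Strict Implicit.
Unset Printing Implicit Defensive.
Import Order.TTheory GRing.Theory Num.Theory.
Local Open Scope ring_scope.

(** In characteristic 2 all signs and structure constants of a simply laced root
system become 1: on M = h + \sum K x_a one may put [x_a, x_b] = x_(a+b) if a+b is
a root, [x_a, x_(-a)] = h_a, [h, x_a] = a(h) x_a, with x_a^2 = 0 for odd a.  The
kernel of the evaluation from the presented algebra onto M is its largest graded
ideal meeting h trivially: that every such ideal lies in the kernel uses the
triangular decomposition in degree 0 and h_a <> 0, as no root a lies in 2Q.
So the contragredient algebra is M.  Since the Cartan matrix is unimodular, h
contains elements acting on x_a by the coordinates of a modulo 2, and two roots
are congruent modulo 2Q only if they are equal or opposite.  Hence a derivation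
can be corrected by an inner one so as to kill h and preserve every
<x_a, x_(-a)>; writing a root as a sum of two others removes the mixing of x_a
with x_(-a), and a toral correction kills the Chevalley generators.  In the same
way a 2-cocycle becomes, modulo coboundaries, zero on the generators, hence zero.
In the super case the remaining freedom is an additive, Frobenius-semilinear
function on the odd part, a combination of squares of odd root coordinates. *)

(** The presented algebra is known only through its universal property, so its structure is studied
    in an arbitrary Lie superalgebra with elements satisfying the Cartan relations. A graded ideal
    is assumed to avoid Span(h_j), not the whole component of degree 0, which could a priori be
    larger; hence the triangular decomposition. The bracket of M does not depend on the parities:
    these enter only the projection [od] and the squaring. One computation therefore serves e(8) and
    both superalgebras. The obstacle special to characteristic 2 is that x_a and x_(-a) have the
    same weight under h. What is needed about Q/2Q comes from the integral quadratic form q, equal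
    to 1 exactly on the roots: q(2w) = 4 q(w) is never 1, and q(a - b) = 2 - (a, b) is a multiple of
    4 when a - b is in 2Q. *)

Section Char2Lie.
Variables (K : fieldType) (charK2 : 2%N \in [pchar K]).

Lemma addvv2 (V : lmodType K) (v : V) : v + v = 0.
Proof. by rewrite -mulr2n -scaler_nat (pcharf0 charK2) scale0r. Qed.

Lemma oppv2 (V : lmodType K) (v : V) : - v = v.
Proof. by apply/eqP; rewrite -subr_eq0 -opprD addvv2 oppr0. Qed.

Lemma addvK2 (V : lmodType K) (v w : V) : w + v + v = w.
Proof. by rewrite -addrA addvv2 addr0. Qed.

Variable L : lieSuper K.
Implicit Types u v w : L.

Lemma brC2 u v : br u v = br v u.
Proof. by rewrite brC oppv2. Qed.

Lemma br_derivl u v w : br (br u v) w = br u (br v w) + br v (br u w).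
Proof.
have := br_jacobi (lieP L) u v w; rewrite [br w (br u v)]brC2 [br w u]brC2.
by move=> J; rewrite -[LHS]add0r -J addvK2.
Qed.

Lemma br_derivr u v w : br u (br v w) = br (br u v) w + br v (br u w).
Proof. by rewrite br_derivl addvK2. Qed.

Lemma sq0 : sq (0 : L) = 0.
Proof. by rewrite -[in LHS](scale0r (0 : L)) (sq_scale (lieP L)) expr0n scale0r. Qed.

Lemma sq_even u : od u = 0 -> sq u = 0.
Proof. by move=> u0; rewrite -(sq_od (lieP L)) u0 sq0. Qed.

Lemma br_suml (I : Type) (r : seq I) (P : pred I) (F : I -> L) w :
  br (\sum_(i <- r | P i) F i) w = \sum_(i <- r | P i) br (F i) w.
Proof.
elim: r => [|i r IH]; first by rewrite !big_nil br0l.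
by rewrite !big_cons; case: (P i); rewrite // brDl IH.
Qed.

Lemma br_sumr (I : Type) (r : seq I) (P : pred I) (F : I -> L) w :
  br w (\sum_(i <- r | P i) F i) = \sum_(i <- r | P i) br w (F i).
Proof. by rewrite brC2 br_suml; apply: eq_bigr => i _; rewrite brC2. Qed.

Lemma od_sum (I : Type) (r : seq I) (P : pred I) (F : I -> L) :
  od (\sum_(i <- r | P i) F i) = \sum_(i <- r | P i) od (F i).
Proof.
elim: r => [|i r IH]; first by rewrite !big_nil od0.
by rewrite !big_cons; case: (P i); rewrite // odD IH.
Qed.

End Char2Lie.

(** * Parity of homogeneous elements *)

Section Parity.
Variables (n : nat) (p : 'I_n -> bool).

Definition weight_parity (d : 'rV[int]_n) : bool := odd `|(\sum_(j | p j) d 0 j)%R|%N.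

Lemma weight_parityD d e : weight_parity (d + e) = weight_parity d (+) weight_parity e.
Proof.
rewrite /weight_parity.
have -> : \sum_(j | p j) (d + e) 0 j = \sum_(j | p j) d 0 j + \sum_(j | p j) e 0 j.
  by rewrite -big_split; apply: eq_bigr => j _; rewrite mxE.
move: (\sum_(j | p j) d 0 j) (\sum_(j | p j) e 0 j) => x y; lia.
Qed.

Lemma weight_parityN d : weight_parity (- d) = weight_parity d.
Proof.
rewrite /weight_parity.
have -> : \sum_(j | p j) (- d) 0 j = - \sum_(j | p j) d 0 j.
  by rewrite -sumrN; apply: eq_bigr => j _; rewrite mxE.
by rewrite abszN.
Qed.

Lemma weight_parity0 : weight_parity 0 = false.
Proof. by rewrite /weight_parity big1 // => j _; rewrite mxE. Qed.

Lemma weight_parity_simple j : weight_parity (delta_mx 0 j) = p j.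
Proof.
rewrite /weight_parity big_mkcond (bigD1 j) //= big1 => [|k /negPf kj]; rewrite !mxE.
  by rewrite !eqxx addr0; case: (p j).
by rewrite kj; case: (p k).
Qed.

Variables (K : fieldType) (charK2 : 2%N \in [pchar K]) (A : 'M[K]_n).
Variables (L : lieSuper K) (g : generator n -> L) (rel : cartan_relations A p g).

(** The degree forces the parity; a square has degree 2d, which is even, in agreement with [od_sq].
    On homogeneous elements the projections in [br_sq] then become harmless. *)
Lemma homogeneous_parity d v : homogeneous g d v -> has_parity (weight_parity d) v.
Proof.
rewrite /has_parity; elim=> {d v} [j|j|j|d|d u v _ IHu _ IHv|d a u _ IHu|d e u v _ IHu _
  IHv|d u _ _].
- by rewrite weight_parity0 (parity_h rel).
- by rewrite weight_parity_simple (parity_x rel).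
- by rewrite weight_parityN weight_parity_simple (parity_y rel).
- by rewrite od0; case: ifP.
- by rewrite odD IHu IHv; case: ifP; rewrite ?addr0.
- by rewrite odZ IHu; case: ifP; rewrite ?scaler0.
- rewrite (od_br (lieP L)) IHu IHv weight_parityD.
  by do 2!case: (weight_parity _); rewrite /= ?subrr ?subr0 ?br0l ?br0r ?addr0 ?add0r.
- by rewrite mulr2n weight_parityD addbb (od_sq (lieP L)).
Qed.

Lemma homogeneous_od d v : homogeneous g d v -> od v = 0 \/ od v = v.
Proof. by move=> /homogeneous_parity ->; case: ifP; [right | left]. Qed.

End Parity.

(** * Triangular decomposition *)

Section Triangular.
Variables (K : fieldType) (charK2 : 2%N \in [pchar K]) (n : nat).
Variables (A : 'M[K]_n) (p : 'I_n -> bool).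
Variables (L : lieSuper K) (g : generator n -> L) (rel : cartan_relations A p g).
Implicit Types (u v w : L) (d e : int) (s : bool).

Let gen s j := g (if s then X j else Y j).
Let sgn s : int := if s then 1 else -1.

(* [half true] is the subalgebra generated by the x_j, [half false] the one
   generated by the y_j; the index is the height, i.e. the sum of the
   coordinates of the degree. *)
Inductive half s : int -> L -> Prop :=
  | half_gen j : half s (sgn s) (gen s j)
  | half_0 d : half s d 0
  | half_add d u v : half s d u -> half s d v -> half s d (u + v)
  | half_scale d a u : half s d u -> half s d (a *: u)
  | half_br d e u v : half s d u -> half s e v -> half s (d + e) (br u v)
  | half_sq d u : half s d u -> half s (d + d) (sq u).

(** The zero vector belongs to [half s d] for every [d], hence the alternative. *)
Lemma half_height s d u : half s d u -> u = 0 \/ 0 < sgn s * d.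
Proof.
elim=> {d u} [j|d|d u v _ [->|IHu] _ [->|IHv]|d a u _ [->|IHu]|d e u v _ [->|IHu] _
  [->|IHv]|d u _ [->|IHu]].
all: rewrite ?br0l ?br0r ?sq0 ?addr0 ?scaler0; auto.
all: by right; move: IHu IHv || move: IHu || idtac; rewrite /sgn; case: s; lia.
Qed.

Definition cartan_part d u := d = 0 /\ span_h g u.
Definition borel s d u := half s d u \/ cartan_part d u.
(** At a given height at most one of the summands n-, h, n+ is nonzero, so a disjunction replaces
    the decomposition into a sum of three terms. *)
Definition triangular d u := borel true d u \/ borel false d u.

Lemma span_hD u v : span_h g u -> span_h g v -> span_h g (u + v).
Proof.
move=> [a ->] [b ->]; exists (fun j => a j + b j).
by rewrite -big_split; apply: eq_bigr => j _; rewrite scalerDl.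
Qed.

Lemma span_hZ a u : span_h g u -> span_h g (a *: u).
Proof.
move=> [b ->]; exists (fun j => a * b j).
by rewrite scaler_sumr; apply: eq_bigr => j _; rewrite scalerA.
Qed.

Lemma span_h0 : span_h g 0.
Proof. by exists (fun=> 0); rewrite big1 // => j _; rewrite scale0r. Qed.

Lemma span_h_gen j : span_h g (g (H j)).
Proof.
exists (fun i => (i == j)%:R); rewrite (bigD1 j) //= eqxx scale1r big1 ?addr0 // => i /negPf ->.
by rewrite scale0r.
Qed.

Lemma od_span_h u : span_h g u -> od u = 0.
Proof.
move=> [a ->]; rewrite od_sum big1 // => j _.
by rewrite odZ; have := parity_h rel j; rewrite /has_parity => ->; rewrite scaler0.
Qed.

Lemma br_span_h u v : span_h g u -> span_h g v -> br u v = 0.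
Proof.
move=> [a ->] [b ->]; rewrite (br_suml) big1 // => i _;
  rewrite brZl (br_sumr charK2) big1 ?scaler0 // => j _.
by rewrite brZr (rel_hh rel) scaler0.
Qed.

Lemma half_od s d u : half s d u -> half s d (od u).
Proof.
elim=> {d u} [j|d|d u v _ IHu _ IHv|d a u _ IHu|d e u v Nu IHu Nv IHv|d u _ _].
- rewrite /gen; case: s => /=.
    by rewrite (parity_x rel); case: (p j); [exact: half_gen true j | exact: half_0].
  by rewrite (parity_y rel); case: (p j); [exact: half_gen false j | exact: half_0].
- by rewrite od0; exact: half_0.
- by rewrite odD; exact: half_add.
- by rewrite odZ; exact: half_scale.
- rewrite (od_br (lieP L)) !(oppv2 charK2).
  by apply: half_add; apply: half_br => //; apply: half_add.
- by rewrite (od_sq (lieP L)); exact: half_0.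
Qed.

Lemma half_br_h s i d u : half s d u -> half s d (br (g (H i)) u).
Proof.
elim=> {d u} [j|d|d u v _ IHu _ IHv|d a u _ IHu|d e u v Nu IHu Nv IHv|d u Nu IHu].
- rewrite /gen; case: s => /=.
    by rewrite (rel_hx rel); apply/half_scale/(half_gen true).
  by rewrite (rel_hy rel); apply/half_scale/(half_gen false).
- by rewrite br0r; exact: half_0.
- by rewrite brDr; exact: half_add.
- by rewrite brZr; exact: half_scale.
- by rewrite br_derivr //; apply: half_add; apply: half_br.
- rewrite brC2 // (br_sq (lieP L)); apply: half_br; first exact: half_od.
  have od_hu : od (br (g (H i)) u) = br (g (H i)) (od u).
    by rewrite (od_br (lieP L)) (parity_h rel) br0l add0r subr0.
  by rewrite brC2 // -od_hu; exact: half_od.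
Qed.

Lemma half_br_span_h s d u v : span_h g u -> half s d v -> half s d (br u v).
Proof.
move=> [a ->] Nv; rewrite br_suml; elim/big_ind: _ => [||i _].
- exact: half_0.
- exact: half_add.
- by rewrite brZl; apply/half_scale/half_br_h.
Qed.

Lemma half_height0 s u : half s 0 u -> u = 0.
Proof. by case/half_height=> //; rewrite mulr0 ltxx. Qed.

Lemma borelD s d u v : borel s d u -> borel s d v -> borel s d (u + v).
Proof.
case=> [Nu|[d0 Cu]] [Nv|[d0' Cv]].
- by left; exact: half_add.
- by right; split=> //; move: Nu; rewrite d0' => /half_height0 ->; rewrite add0r.
- by right; split=> //; move: Nv; rewrite d0 => /half_height0 ->; rewrite addr0.
- by right; split=> //; exact: span_hD.
Qed.

Lemma borelZ s d a u : borel s d u -> borel s d (a *: u).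
Proof. by case=> [Nu|[d0 Cu]]; [left; exact: half_scale | right; split=> //;
  exact: span_hZ]. Qed.

Lemma borel_od s d u : borel s d u -> borel s d (od u).
Proof.
by case=> [Nu|[d0 /od_span_h ->]]; left; [exact: half_od | exact: half_0].
Qed.

Lemma borel_br_nilp s d e u v : borel s d u -> half s e v -> half s (d + e) (br u v).
Proof.
case=> [Nu|[-> Cu]] Nv; first exact: half_br.
by rewrite add0r; exact: half_br_span_h.
Qed.

Lemma gen_parity s j : od (gen s j) = if p j then gen s j else 0.
Proof. by rewrite /gen; case: s => /=; [exact: (parity_x rel) | exact: (parity_y rel)]. Qed.

(** Only a bracket of two generators reaches h. For [u, v] the Leibniz rule leaves brackets of a
    Borel element with an element of the nilpotent half, and these fall back into that half; u^2 is
    handled alike through [u^2, x] = [u, [u, x]]. *)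
Lemma opposite_br s j d u : half (~~ s) d u -> borel (~~ s) (sgn s + d) (br (gen s j) u).
Proof.
elim=> {d u} [i|d|d u v _ IHu _ IHv|d a u _ IHu|d e u v Nu IHu Nv IHv|d u Nu IHu].
- right; split; first by case: (s).
  have xy k l : span_h g (br (g (X k)) (g (Y l))).
    by rewrite (rel_xy rel); case: ifP => _; [exact: span_h_gen | exact: span_h0].
  by rewrite /gen; case: (s) => /=; rewrite 1?brC2 //; apply: xy || rewrite brC2.
- by rewrite br0r; left; exact: half_0.
- by rewrite brDr; exact: borelD.
- by rewrite brZr; exact: borelZ.
- rewrite br_derivr //; left; apply: half_add.
    by rewrite addrA; exact: borel_br_nilp.
  by rewrite addrCA brC2 // addrC; exact: borel_br_nilp.
- rewrite brC2 // (br_sq (lieP L)) [br _ (br _ _)]brC2 // addrA; left.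
  apply: borel_br_nilp; last exact: half_od.
  (* The odd part of [x, u], with x the generator, is [x, od u] for even x and [x, u] + [x, od u]
     for odd x; in the second case [x, od u] is recovered by adding [x, u]. *)
  have := borel_od IHu; rewrite (od_br (lieP L)) gen_parity brC2 // !(oppv2 charK2).
  case: (p j); rewrite ?addvv2 ?br0l ?br0r ?addr0 ?add0r 1?brC2 //.
  rewrite brDr => B; rewrite brC2 // -[br _ _](addvK2 charK2 (br (gen s j) u)).
  by apply: borelD => //; rewrite [br _ _ + _]addrC.
Qed.

Lemma triangular0 d : triangular d 0.
Proof. by left; left; exact: half_0. Qed.

Lemma triangular_borel s d u : borel s d u -> triangular d u.
Proof. by case: s; [left | right]. Qed.

Lemma triangularD d u v : triangular d u -> triangular d v -> triangular d (u + v).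
Proof.
have mixed s t x y : borel s d x -> borel t d y -> triangular d (x + y).
  move=> Bx By; case: (eqVneq s t) => [st|st].
    by apply: (@triangular_borel s); rewrite -st in By; exact: borelD.
  case: Bx By => [Nx|Cx] By; last first.
    by apply: (@triangular_borel t); apply: borelD => //; right.
  case: By => [Ny|Cy]; last first.
    by apply: (@triangular_borel s); apply: borelD; [left | right].
  case: (half_height Nx) => [->|dx]; first by rewrite add0r; apply: (@triangular_borel t); left.
  case: (half_height Ny) => [->|dy]; first by rewrite addr0; apply: (@triangular_borel s); left.
  by move: st dx dy; rewrite /sgn; case: (s) (t) => [] [] // _; lia.
by move=> [] Bu [] Bv; apply: mixed Bu Bv.
Qed.

Lemma triangularZ d a u : triangular d u -> triangular d (a *: u).
Proof. by case=> B; [left | right]; exact: borelZ. Qed.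

Lemma triangular_br_gen s j d u : triangular d u -> triangular (sgn s + d) (br (gen s j) u).
Proof.
have mixed t : borel t d u -> triangular (sgn s + d) (br (gen s j) u).
  case=> [Nu|[-> [a ->]]]; last first.
    apply: (@triangular_borel s); left; rewrite addr0 (br_sumr charK2).
    elim/big_ind: _ => [||i _]; [exact: half_0 | exact: half_add |].
    by rewrite brZr brC2 //; apply/half_scale/half_br_h/half_gen.
  case: (eqVneq t s) Nu => [->|] Nu.
    by apply: (@triangular_borel s); left; apply: half_br => //; exact: half_gen.
  have -> : t = ~~ s by case: (t) (s) Nu => [] [].
  by move=> N; apply: (@triangular_borel (~~ s)); exact: opposite_br.
by case; apply: mixed.
Qed.

Lemma triangular_br_h i d u : triangular d u -> triangular d (br (g (H i)) u).
Proof.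
have mixed s : borel s d u -> triangular d (br (g (H i)) u).
  case=> [Nu|[_ Cu]]; first by apply: (@triangular_borel s); left; exact: half_br_h.
  by rewrite br_span_h //; [exact: triangular0 | exact: span_h_gen].
by case; apply: mixed.
Qed.

Lemma triangular_sq d u : triangular d u -> triangular (d + d) (sq u).
Proof.
have mixed s : borel s d u -> triangular (d + d) (sq u).
  case=> [Nu|[_ /od_span_h Cu]]; first by apply: (@triangular_borel s); left; exact: half_sq.
  by rewrite sq_even //; exact: triangular0.
by case; apply: mixed.
Qed.

Definition height (d : 'rV[int]_n) : int := \sum_j d 0 j.

Lemma heightD (d e : 'rV[int]_n) : height (d + e) = height d + height e.
Proof. by rewrite /height -big_split; apply: eq_bigr => j _; rewrite mxE. Qed.

Lemma heightN (d : 'rV[int]_n) : height (- d) = - height d.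
Proof. by rewrite /height -sumrN; apply: eq_bigr => j _; rewrite mxE. Qed.

Lemma height0 : height 0 = 0.
Proof. by rewrite /height big1 // => j _; rewrite mxE. Qed.

Lemma height_simple j : height (delta_mx 0 j) = 1.
Proof.
rewrite /height (bigD1 j) //= big1 => [|k /negPf kj]; rewrite !mxE ?eqxx ?addr0 //.
by rewrite kj.
Qed.

(** The second conjunct carries the induction: brackets of arbitrary homogeneous elements occur,
    while so far only brackets with generators are controlled. Operators preserving [triangular] are
    closed under commutators, so ad u is treated together with u. Only the height of the degree has
    to be kept. *)
Lemma homogeneous_triangular (d : 'rV[int]_n) u : homogeneous g d u ->
  triangular (height d) u /\
  forall e v, triangular e v -> triangular (height d + e) (br u v).
Proof.
elim=> {d u} [j|j|j|d|d u v _ [Tu IHu] _ [Tv IHv]|d a u _ [Tu IHu]|d e u v _ [Tu IHu] _ [Tv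
  IHv]|d u Hu [Tu IHu]].
- rewrite height0; split=> [|e v Tv]; last by rewrite add0r; exact: triangular_br_h.
  by left; right; split=> //; exact: span_h_gen.
- rewrite height_simple; split=> [|e v Tv]; last exact: (triangular_br_gen true).
  by left; left; exact: (half_gen true).
- rewrite heightN height_simple; split=> [|e v Tv]; last exact: (triangular_br_gen false).
  by right; left; exact: (half_gen false).
- by split=> [|e v _]; rewrite ?br0l; exact: triangular0.
- split=> [|e w Tw]; first exact: triangularD.
  by rewrite brDl; apply: triangularD; auto.
- split=> [|e w Tw]; first exact: triangularZ.
  by rewrite brZl; apply: triangularZ; auto.
- rewrite heightD; split=> [|f w Tw]; first exact: IHu.
  rewrite br_derivl //; apply: triangularD; first by rewrite -addrA; auto.
  by rewrite [height d + _]addrC -addrA; auto.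
- rewrite mulr2n heightD; split=> [|f w Tw]; first exact: triangular_sq.
  rewrite (br_sq (lieP L)) -addrA.
  by case: (homogeneous_od rel Hu) => ->; [rewrite br0l; exact: triangular0 | auto].
Qed.

Lemma homogeneous0_span_h u : homogeneous g 0 u -> span_h g u.
Proof.
case/homogeneous_triangular=> + _; rewrite height0 => -[] [/half_height0 ->|[]//].
all: exact: span_h0.
Qed.

End Triangular.

(** * Homogeneous components *)

Section HomogeneousSums.
Variables (K : fieldType) (charK2 : 2%N \in [pchar K]) (n : nat).
Variables (A : 'M[K]_n) (p : 'I_n -> bool).

Inductive homogeneous_span (L : lieSuper K) (g : generator n -> L) : L -> Prop :=
  | hspan_0 : homogeneous_span g 0
  | hspan_add d u v :
      homogeneous g d u -> homogeneous_span g v -> homogeneous_span g (u + v).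

Section Closure.
Variables (L : lieSuper K) (g : generator n -> L) (rel : cartan_relations A p g).

Lemma homogeneous_spanD u v :
  homogeneous_span g u -> homogeneous_span g v -> homogeneous_span g (u + v).
Proof.
by elim=> [|d u1 u2 H1 _ IH] Sv; rewrite ?add0r // -addrA; apply: hspan_add H1 (IH Sv).
Qed.

Lemma span_homogeneous d u : homogeneous g d u -> homogeneous_span g u.
Proof. by move=> Hu; rewrite -[u]addr0; apply: hspan_add Hu (hspan_0 g). Qed.

Lemma homogeneous_spanZ a u : homogeneous_span g u -> homogeneous_span g (a *: u).
Proof.
elim=> [|d u1 u2 H1 _ IH]; first by rewrite scaler0; exact: hspan_0.
by rewrite scalerDr; apply: hspan_add IH; apply: hom_scale H1.
Qed.

Lemma homogeneous_span_od u : homogeneous_span g u -> homogeneous_span g (od u).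
Proof.
elim=> [|d u1 u2 H1 _ IH]; first by rewrite od0; exact: hspan_0.
by rewrite odD; case: (homogeneous_od rel H1) => ->; [rewrite add0r | exact: hspan_add H1 IH].
Qed.

Lemma homogeneous_span_br u v :
  homogeneous_span g u -> homogeneous_span g v -> homogeneous_span g (br u v).
Proof.
elim=> [|d u1 u2 H1 _ IH1] Sv; first by rewrite br0l; exact: hspan_0.
rewrite brDl; apply: homogeneous_spanD (IH1 Sv).
elim: Sv => [|e v1 v2 H2 _ IH2]; first by rewrite br0r; exact: hspan_0.
by rewrite brDr; apply: hspan_add IH2; apply: hom_br H1 H2.
Qed.

Lemma homogeneous_span_sq u : homogeneous_span g u -> homogeneous_span g (sq u).
Proof.
elim=> [|d u1 u2 H1 S2 IH]; first by rewrite sq0 //; exact: hspan_0.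
rewrite sqD; apply: homogeneous_spanD.
  by apply: hspan_add IH; apply: hom_sq H1.
by apply: homogeneous_span_br; apply: homogeneous_span_od => //; exact: span_homogeneous H1.
Qed.

Lemma homogeneous_span_eval t : homogeneous_span g (eval g t).
Proof.
elim: t => [[] j||t1 IH1 t2 IH2|t1 IH1|a t1 IH1|t1 IH1|t1 IH1 t2 IH2|t1 IH1] /=.
- exact: span_homogeneous (hom_h g j).
- exact: span_homogeneous (hom_x g j).
- exact: span_homogeneous (hom_y g j).
- exact: hspan_0.
- exact: homogeneous_spanD.
- by rewrite -scaleN1r; exact: homogeneous_spanZ.
- exact: homogeneous_spanZ.
- exact: homogeneous_span_od.
- exact: homogeneous_span_br.
- exact: homogeneous_span_sq.
Qed.

(** Collects summands of equal degree: with distinct degrees, a relation in the model can be tested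
    component by component. *)
Lemma homogeneous_components u : homogeneous_span g u ->
  exists (ds : seq 'rV[int]_n) (F : 'rV[int]_n -> L),
    [/\ uniq ds, u = \sum_(d <- ds) F d & forall d, homogeneous g d (F d)].
Proof.
elim=> [|d v w Hv _ [ds [F [ds_uniq -> HF]]]].
  by exists [::], (fun=> 0); split=> [||d] //; [rewrite big_nil | exact: hom_0].
case: (boolP (d \in ds)) => ds_d.
  exists ds, (fun e => if e == d then v + F e else F e); split=> // [|e]; last first.
    by case: eqP => // ->; exact: hom_add.
  rewrite (bigD1_seq d) //= [in RHS](bigD1_seq d) //= eqxx addrA; congr (_ + _).
  by apply: eq_bigr => e /negPf ->.
exists (d :: ds), (fun e => if e == d then v else F e); split=> [||e] /=.
- by rewrite ds_d.
- rewrite big_cons eqxx; congr (_ + _); rewrite big_seq [RHS]big_seq.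
  by apply: eq_bigr => e ds_e; case: eqP => // ed; rewrite -ed ds_e in ds_d.
- by case: eqP => // ->.
Qed.

End Closure.

Lemma eval_gtilde (t : term K n) : eval (@gtilde_gen K n A p) t = cls A p t.
Proof.
rewrite -[RHS](repK (cls A p t)).
suff E (s : term K n) : eval (@gtilde_gen K n A p) s = cls A p s by rewrite repK E.
elim: s => [s||t1 IH1 t2 IH2|t1 IH1|a t1 IH1|t1 IH1|t1 IH1 t2 IH2|t1 IH1] //=.
all: by rewrite ?IH1 ?IH2; apply/clsP => L g r /=; rewrite !eval_rep.
Qed.

End HomogeneousSums.

(** * Roots of a simply laced lattice *)

Section Lattice.
Variables (n : nat) (U : 'M[int]_n).
Implicit Types u v w : 'rV[int]_n.

Let trD v w : (v + w)^T = v^T + w^T := raddfD _ v w.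

Definition lform v w : int := (v *m (U + U^T) *m w^T) 0 0.
Definition qform v : int := (v *m U *m v^T) 0 0.

Lemma lformE v w : lform v w = (v *m (U + U^T) *m w^T) 0 0.
Proof. by []. Qed.

Lemma lformDl u v w : lform (u + v) w = lform u w + lform v w.
Proof. by rewrite /lform !mulmxDl mxE. Qed.

Lemma lformDr u v w : lform u (v + w) = lform u v + lform u w.
Proof. by rewrite /lform trD mulmxDr mxE. Qed.

Lemma lformNl u v : lform (- u) v = - lform u v.
Proof. by rewrite /lform !mulNmx mxE. Qed.

Lemma lformNr u v : lform u (- v) = - lform u v.
Proof. by rewrite /lform raddfN /= mulmxN mxE. Qed.

Lemma lformC u v : lform u v = lform v u.
Proof.
rewrite /lform -[in LHS](trmxK (u *m _ *m _)) mxE !trmx_mul trmxK mulmxA.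
by rewrite raddfD /= trmxK [U^T + U]addrC.
Qed.

Lemma lform0r u : lform u 0 = 0.
Proof. by rewrite /lform trmx0 mulmx0 mxE. Qed.

Lemma lform_suml (I : Type) (r : seq I) (F : I -> 'rV[int]_n) w :
  lform (\sum_(i <- r) F i) w = \sum_(i <- r) lform (F i) w.
Proof.
elim: r => [|i r IH]; first by rewrite !big_nil lformC lform0r.
by rewrite !big_cons lformDl IH.
Qed.

Lemma lformZl (a : int) v w : lform (a *: v) w = a * lform v w.
Proof. by rewrite /lform -!scalemxAl mxE. Qed.

Lemma lform_coord v w : lform v w = \sum_j v 0 j * lform (delta_mx 0 j) w.
Proof.
by rewrite [v in LHS]row_sum_delta lform_suml; apply: eq_bigr => j _; rewrite lformZl.
Qed.

Lemma qformD u v : qform (u + v) = qform u + qform v + lform u v.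
Proof.
have D (x y : 'M[int]_1) : (x + y) 0 0 = x 0 0 + y 0 0 by rewrite mxE.
rewrite /qform /lform trD !(mulmxDl, mulmxDr) !D.
have -> : (u *m U^T *m v^T) 0 0 = (v *m U *m u^T) 0 0.
  by rewrite -[in LHS](trmxK (u *m _ *m _)) mxE !trmx_mul !trmxK mulmxA.
by rewrite addrACA [RHS]addrACA; congr (_ + _); exact: addrC.
Qed.

Lemma qformN v : qform (- v) = qform v.
Proof. by rewrite /qform raddfN /= mulmxN !mulNmx opprK. Qed.

Lemma qform0 : qform 0 = 0.
Proof. by rewrite /qform !mul0mx mxE. Qed.

Lemma lform_diag v : lform v v = 2 * qform v.
Proof.
have := qformD v (- v); rewrite subrr qform0 qformN lformNr; lia.
Qed.

Lemma lform_simple i j : lform (delta_mx 0 i) (delta_mx 0 j) = (U + U^T) i j.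
Proof.
by rewrite /lform -rowE trmx_delta -colE !mxE.
Qed.

Definition posdef := forall v, 0 <= qform v ?= iff (v == 0).

Hypothesis qpos : posdef.

Definition is_root v := qform v == 1.

Lemma is_rootN v : is_root (- v) = is_root v.
Proof. by rewrite /is_root qformN. Qed.

Lemma is_root0 : is_root 0 = false.
Proof. by rewrite /is_root qform0. Qed.

Lemma root_neq0 v : is_root v -> v != 0.
Proof. by apply: contraTneq => ->; rewrite is_root0. Qed.

Lemma root_diag v : is_root v -> lform v v = 2.
Proof. by move/eqP=> v1; rewrite lform_diag v1. Qed.

(** For roots q(v + w) = 2 + (v, w). Positivity bounds the product, and the values -2 and -1 say
    that v + w is zero or a root. *)
Lemma root_form_ge v w : is_root v -> is_root w -> - 2 <= lform v w.
Proof. by move=> /eqP v1 /eqP w1; have := (qpos (v + w)).1; rewrite qformD v1 w1; lia. Qed.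

Lemma root_form_le v w : is_root v -> is_root w -> lform v w <= 2.
Proof. by rewrite -(is_rootN w) => v1 /(root_form_ge v1); rewrite lformNr; lia. Qed.

Lemma root_opp v w : is_root v -> is_root w -> (v + w == 0) = (lform v w == -2).
Proof.
move=> /eqP v1 /eqP w1; rewrite -(qpos (v + w)).2 qformD v1 w1.
by apply/eqP/eqP; lia.
Qed.

Lemma root_eq v w : is_root v -> is_root w -> (v == w) = (lform v w == 2).
Proof.
move=> v1 w1; rewrite -subr_eq0 root_opp ?is_rootN // lformNr.
by apply/eqP/eqP; lia.
Qed.

Lemma root_add v w : is_root v -> is_root w -> is_root (v + w) = (lform v w == -1).
Proof. by move=> /eqP v1 /eqP w1; rewrite /is_root qformD v1 w1; apply/eqP/eqP; lia. Qed.

Lemma int_half v : (forall k, ~~ odd `|v 0%R k|%N) -> exists w, v = w + w.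
Proof.
move=> v_even; exists (\row_k (v 0%R k %/ 2)%Z); apply/rowP => k; rewrite !mxE.
by have := v_even k; move: (v 0 k) => z; lia.
Qed.

(** Otherwise v = 2w, and q(v) = 4 q(w) is not 1. *)
Lemma root_odd v : is_root v -> exists k, odd `|v 0%R k|%N.
Proof.
move=> rv; apply/existsP; apply: contraTT rv => /existsPn /int_half [w ->].
by rewrite /is_root qformD lform_diag; apply/eqP; lia.
Qed.

(** If v - w = 2x, then 2 - (v, w) = 4 q(x); between -2 and 2 this leaves (v, w) = 2 or -2. *)
Lemma root_mod2 v w : is_root v -> is_root w ->
  (forall k, odd `|v 0%R k|%N = odd `|w 0%R k|%N) -> w = v \/ w = - v.
Proof.
move=> rv rw vw; have [|x vwx] := @int_half (v - w).
  by move=> k; rewrite !mxE; have := vw k; move: (v 0 k) (w 0 k) => a b; lia.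
have : qform (v - w) = 4 * qform x by rewrite vwx qformD lform_diag; lia.
rewrite qformD qformN (eqP rv) (eqP rw) lformNr => f.
have := root_form_le rv rw; have := root_form_ge rv rw => f1 f2.
have : (lform v w == 2) || (lform v w == -2) by move: f f1 f2;
  move: (lform v w) (qform x) => a b; lia.
rewrite -root_eq // -root_opp // => /orP[/eqP->|]; [by left | right].
by apply/eqP; rewrite -addr_eq0 addrC.
Qed.

Hypothesis diagU : forall i, U i i = 1.
Local Notation simple j := (delta_mx 0 j : 'rV[int]_n).

Lemma root_simple j : is_root (simple j).
Proof.
have := lform_diag (simple j); rewrite lform_simple !mxE diagU /is_root => qj.
by apply/eqP; move: qj; lia.
Qed.

Definition abs_height v : nat := \sum_j `|v 0%R j|%N.

(* As \sum_j v_j (a_j, v) = 2 > 0, some simple root a_j satisfies v_j (a_j, v) > 0;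
   subtracting the simple root of that sign brings v closer to 0. *)
Lemma root_reduction v : is_root v -> exists2 b : 'rV[int]_n,
  (exists j, b = simple j \/ b = - simple j) &
  v = b \/ is_root (v - b) /\ (abs_height (v - b) < abs_height v)%N.
Proof.
move=> rv.
have [j vj] : exists j, 0 < v 0 j * lform (simple j) v.
  apply/existsP; apply: contraTT isT => /existsPn npos.
  have := root_diag rv; rewrite lform_coord => v2.
  suff : \sum_j v 0 j * lform (simple j) v <= 0 by rewrite v2.
  by apply: sumr_le0 => j _; rewrite leNgt npos.
pose b : 'rV[int]_n := if 0 < v 0 j then simple j else - simple j.
have rb : is_root b by rewrite /b; case: ifP; rewrite ?is_rootN root_simple.
have fb : 0 < lform b v.
  rewrite /b; case: ifP => v0; first by move: vj; rewrite pmulr_rgt0.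
  rewrite lformNl oppr_gt0 -(nmulr_rgt0 _ (x := v 0 j)) //.
  move: v0 vj; case: (ltrgtP (v 0 j) 0) => // ->; by rewrite mul0r.
exists b; first by exists j; rewrite /b; case: ifP; [left | right].
case: (eqVneq v b) => [|vb]; [by left | right].
split.
  rewrite root_add ?is_rootN // lformNr lformC eqr_opp.
  have := root_form_le rb rv; move: vb; rewrite eq_sym root_eq //.
  by move: fb; move: (lform b v) => f; lia.
rewrite /abs_height (bigD1 j) //= [X in (_ < X)%N](bigD1 j) //=.
rewrite (eq_bigr (fun i => `|v 0%R i|%N)) => [|i /negPf ij]; last first.
  by rewrite !mxE /b; case: ifP => _; rewrite !mxE ij andbF ?oppr0 addr0.
rewrite ltn_add2r !mxE /b; move: vj; case: (ltrgtP 0 (v 0 j)) => [v0|v0|<-];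
  last by rewrite mul0r ltxx.
all: rewrite !mxE !eqxx /= => _; move: v0; move: (v 0 j) => k; lia.
Qed.

(** Positive and negative roots are reached together; no choice of a positive system is involved. *)
Lemma root_ind (P : 'rV[int]_n -> Prop) :
  (forall j, P (simple j)) -> (forall j, P (- simple j)) ->
  (forall v w, is_root v -> is_root w -> is_root (v + w) -> P v -> P w -> P (v + w)) ->
  forall v, is_root v -> P v.
Proof.
move=> Pp Pn PD v; have [m] := ubnP (abs_height v); elim: m v => // m IH v vm rv.
have [b [j bj]] := root_reduction rv.
have Pb : P b by case: bj => ->.
case=> [->//|[rvb vb_lt]]; rewrite -(subrK b v).
have rb : is_root b by case: bj => ->; rewrite ?is_rootN root_simple.
by apply: (PD); rewrite ?subrK //; apply: IH => //; apply: leq_trans vb_lt _.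
Qed.

End Lattice.

(** * The model in characteristic 2 *)

Section Model.
Variables (n : nat) (U : 'M[int]_n) (roots : seq 'rV[int]_n).
Hypothesis qpos : posdef U.
Hypothesis rootsE : forall v, (v \in roots) = is_root U v.
Variables (K : fieldType) (charK2 : 2%N \in [pchar K]) (p : 'I_n -> bool).
Implicit Types v w : 'rV[int]_n.

Local Notation lform := (lform U).
Local Notation is_root := (is_root U).
Local Notation basis := ('I_n + seq_sub roots)%type.
Definition model := {ffun basis -> K^o}.
Local Notation M := model.
HB.instance Definition _ := GRing.Lmodule.on model.
Implicit Types (x y z : M) (a : 'rV[K]_n).

Definition hvec a : M := [ffun b => if b is inl j then a 0 j else 0].
Definition rvec v : M := [ffun b => if b is inr r then (v == ssval r)%:R else 0].
(** In the simply laced case a coroot has in the simple coroots the same coordinates as the root in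
    the simple roots. *)
Definition coroot v : M := hvec (map_mx intr v).
(** The value on [hvec a] of the weight v reduced modulo 2. *)
Definition eigen a v : K := \sum_i a 0 i * (lform (delta_mx 0 i) v)%:~R.

Lemma hvecD a a' : hvec (a + a') = hvec a + hvec a'.
Proof. by apply/ffunP => -[j|r]; rewrite !ffunE ?mxE ?addr0. Qed.

Lemma hvecZ c a : hvec (c *: a) = c *: hvec a.
Proof. by apply/ffunP => -[j|r]; rewrite !ffunE ?mxE ?scaler0. Qed.

Lemma rvec_nroot v : ~~ is_root v -> rvec v = 0.
Proof.
move=> nv; apply/ffunP => -[j|r]; rewrite !ffunE //.
by case: eqP => // vr; move: nv; rewrite vr -rootsE ssvalP.
Qed.

Lemma model_ind (P : M -> Prop) :
  (forall x y, P x -> P y -> P (x + y)) -> (forall c x, P x -> P (c *: x)) ->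
  (forall a, P (hvec a)) -> (forall v, is_root v -> P (rvec v)) -> forall x, P x.
Proof.
move=> PD PZ Ph Px x.
have -> : x = hvec (\row_j x (inl j)) + \sum_(r : seq_sub roots) x (inr r) *: rvec (ssval r).
  apply/ffunP => -[j|r]; rewrite !ffunE sum_ffunE ?mxE.
    by rewrite big1 ?addr0 // => r _; rewrite !ffunE scaler0.
  rewrite add0r (bigD1 r) //= big1 => [|s /negPf sr]; rewrite !ffunE.
    by rewrite eqxx addr0 /GRing.scale /= mulr1.
  by rewrite (inj_eq val_inj) sr scaler0.
apply: (PD) => //; elim/big_ind: _ => [||r _]; last 1 first.
- by apply/PZ/Px; rewrite -rootsE ssvalP.
- by rewrite -(scale0r (hvec 0)); apply: PZ.
- exact: PD.
Qed.

(** Since [rvec] vanishes off the roots, the entry for two roots needs no test that their sum is a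
    root. *)
Definition bracket_table (b c : basis) : M :=
  match b, c with
  | inl i, inl j => 0
  | inl i, inr r | inr r, inl i => (lform (delta_mx 0 i) (ssval r))%:~R *: rvec (ssval r)
  | inr r, inr s =>
      rvec (ssval r + ssval s) + (ssval r + ssval s == 0)%:R *: coroot (ssval r)
  end.

Definition mbr x y : M := \sum_b \sum_c (x b * y c) *: bracket_table b c.

Lemma mbrDl x y z : mbr (x + y) z = mbr x z + mbr y z.
Proof.
rewrite /mbr -big_split; apply: eq_bigr => b _; rewrite -big_split; apply: eq_bigr => c _.
by rewrite ffunE mulrDl scalerDl.
Qed.

Lemma mbrDr x y z : mbr z (x + y) = mbr z x + mbr z y.
Proof.
rewrite /mbr -big_split; apply: eq_bigr => b _; rewrite -big_split; apply: eq_bigr => c _.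
by rewrite ffunE mulrDr scalerDl.
Qed.

Lemma mbrZl k x y : mbr (k *: x) y = k *: mbr x y.
Proof.
rewrite /mbr scaler_sumr; apply: eq_bigr => b _; rewrite scaler_sumr; apply: eq_bigr => c _.
by rewrite ffunE scalerA mulrA.
Qed.

Lemma mbrZr k x y : mbr x (k *: y) = k *: mbr x y.
Proof.
rewrite /mbr scaler_sumr; apply: eq_bigr => b _; rewrite scaler_sumr; apply: eq_bigr => c _.
by rewrite ffunE scalerA mulrCA.
Qed.

Lemma mbr0r x : mbr x 0 = 0.
Proof. by rewrite -[X in mbr x X](scale0r 0) mbrZr scale0r. Qed.

Lemma mbr0l x : mbr 0 x = 0.
Proof. by rewrite -[X in mbr X x](scale0r 0) mbrZl scale0r. Qed.

Lemma int_pchar2 (z : int) : z%:~R = (odd `|z|%N)%:R :> K.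
Proof.
have nat2 m : m%:R = (odd m)%:R :> K.
  by rewrite -[in LHS](odd_double_half m) natrD -mul2n natrM (pcharf0 charK2) mul0r addr0.
case: (intP z) => [|m|m]; rewrite ?mulr0z //.
  by rewrite -pmulrn (nat2 m.+1).
by rewrite mulrNz (oppr_pchar2 charK2) -pmulrn (nat2 m.+1) abszN.
Qed.

Lemma coroot_opp v w : v + w = 0 -> coroot v = coroot w.
Proof.
move/eqP; rewrite addr_eq0 => /eqP ->; apply/ffunP => -[j|r]; rewrite !ffunE //.
by rewrite !mxE !int_pchar2 abszN.
Qed.

Lemma corootD v w : coroot (v + w) = coroot v + coroot w.
Proof. by rewrite /coroot map_mxD hvecD. Qed.

Lemma coroot0 : coroot 0 = 0.
Proof. by apply/ffunP => -[j|r]; rewrite !ffunE ?mxE. Qed.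

Lemma bracket_tableC b c : bracket_table b c = bracket_table c b.
Proof.
case: b c => [i|r] [j|s] //=; rewrite addrC [ssval s + _]addrC.
by rewrite [RHS]addrC; case: eqP => [rs|_]; rewrite ?scale0r // (coroot_opp rs).
Qed.

Lemma mbrC x y : mbr x y = mbr y x.
Proof.
rewrite /mbr exchange_big; apply: eq_bigr => c _; apply: eq_bigr => b _.
by rewrite mulrC bracket_tableC.
Qed.

Lemma mbr_rvec v w : is_root v -> is_root w ->
  mbr (rvec v) (rvec w) = rvec (v + w) + (v + w == 0)%:R *: coroot v.
Proof.
rewrite -!rootsE => rv rw; rewrite /mbr.
rewrite (bigD1 (inr (SeqSub rv))) //= [X in _ + X]big1 ?addr0 => [|b bv].
  rewrite (bigD1 (inr (SeqSub rw))) //= [X in _ + X]big1 ?addr0 => [|c cw].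
    by rewrite !ffunE /= !eqxx mulr1 scale1r.
  rewrite [rvec w c]ffunE; case: c cw => [j|s] cw; rewrite ?mulr0 ?scale0r //.
  by case: eqP => [ws|_]; rewrite ?mulr0 ?scale0r //; case/eqP: cw; congr inr; apply: val_inj.
apply: big1 => c _; rewrite [rvec v b]ffunE; case: b bv => [j|s] bv; rewrite ?mul0r ?scale0r //.
by case: eqP => [ws|_]; rewrite ?mul0r ?scale0r //; case/eqP: bv; congr inr; apply: val_inj.
Qed.

Lemma mbr_hvec_rvec a v : mbr (hvec a) (rvec v) = eigen a v *: rvec v.
Proof.
case: (boolP (is_root v)) => [|/rvec_nroot->]; last by rewrite mbr0r scaler0.
rewrite -!rootsE => rv; rewrite /mbr big_sumType /= [X in _ + X]big1 ?addr0 => [|r _].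
  rewrite /eigen scaler_suml; apply: eq_bigr => i _.
  rewrite (bigD1 (inr (SeqSub rv))) //= [X in _ + X]big1 ?addr0 => [|c cv].
    by rewrite !ffunE eqxx mulr1 scalerA.
  rewrite [rvec v c]ffunE; case: c cv => [j|s] cv; rewrite ?mulr0 ?scale0r //.
  by case: eqP => [ws|_]; rewrite ?mulr0 ?scale0r //; case/eqP: cv; congr inr; apply: val_inj.
by apply: big1 => c _; rewrite [hvec a _]ffunE mul0r scale0r.
Qed.

Lemma mbr_hvec a a' : mbr (hvec a) (hvec a') = 0.
Proof.
rewrite /mbr; apply: big1 => -[i|r] _; apply: big1 => -[j|s] _ /=; first exact: scaler0.
all: by rewrite !ffunE ?mul0r ?mulr0 scale0r.
Qed.

Lemma eigenD a v w : eigen a (v + w) = eigen a v + eigen a w.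
Proof. by rewrite -big_split; apply: eq_bigr => i _; rewrite lformDr rmorphD mulrDr. Qed.

Lemma eigen0 a : eigen a 0 = 0.
Proof. by rewrite /eigen big1 // => i _; rewrite lform0r mulr0. Qed.

Lemma eigen_coroot v w : eigen (map_mx intr v) w = (lform v w)%:~R.
Proof.
by rewrite lform_coord rmorph_sum; apply: eq_bigr => i _; rewrite mxE rmorphM.
Qed.

Lemma mbr_rvec_gen v w : is_root w ->
  mbr (rvec v) (rvec w) = (is_root v)%:R *: (rvec (v + w) + (v + w == 0)%:R *: coroot w).
Proof.
move=> rw; case: (boolP (is_root v)) => rv; last by rewrite rvec_nroot // mbr0l scale0r.
by rewrite mbr_rvec // scale1r; case: eqP => [vw|]; rewrite ?(coroot_opp vw) ?scale0r.
Qed.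

Lemma mbr_alt x : mbr x x = 0.
Proof.
elim/model_ind: x => [x y xx yy|c x xx|a|v rv].
- by rewrite mbrDl !mbrDr xx yy add0r addr0 mbrC addvv2.
- by rewrite mbrZl mbrZr xx !scaler0.
- exact: mbr_hvec.
- rewrite mbr_rvec // (root_opp qpos) // root_diag // scale0r addr0 rvec_nroot // root_add //.
  by rewrite root_diag.
Qed.

#[local] Opaque mbr hvec rvec coroot eigen.

Lemma natb_addb (b c : bool) : b%:R + c%:R = (b (+) c)%:R :> K.
Proof. by case: b c => [] []; rewrite ?addr0 ?add0r ?(addrr_pchar2 charK2). Qed.

(** Being cyclic, it needs linearity in its first argument only; rotation moves any argument
    there. *)
Definition jacobiator x y z := mbr x (mbr y z) + mbr y (mbr z x) + mbr z (mbr x y).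

Lemma jacobiator_rot x y z : jacobiator x y z = jacobiator y z x.
Proof. by rewrite /jacobiator -addrA addrC. Qed.

Lemma jacobiatorD x x' y z :
  jacobiator (x + x') y z = jacobiator x y z + jacobiator x' y z.
Proof.
rewrite /jacobiator !(mbrDl, mbrDr).
by rewrite [RHS]addrACA (addrACA (mbr x _)).
Qed.

Lemma jacobiatorZ c x y z : jacobiator (c *: x) y z = c *: jacobiator x y z.
Proof. by rewrite /jacobiator !(mbrZl, mbrZr) !scalerDr. Qed.

Lemma jacobiator_hh a a' x : jacobiator (hvec a) (hvec a') x = 0.
Proof.
elim/model_ind: x => [x y Jx Jy|c x Jx|b|v rv].
- by rewrite -jacobiator_rot jacobiatorD !(jacobiator_rot _ (hvec a)) Jx Jy addr0.
- by rewrite -jacobiator_rot jacobiatorZ !(jacobiator_rot _ (hvec a)) Jx scaler0.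
- by rewrite /jacobiator !mbr_hvec !mbr0r !addr0.
- rewrite /jacobiator mbr_hvec mbr0r addr0 [mbr _ (hvec a)]mbrC !mbr_hvec_rvec !mbrZr.
  by rewrite !mbr_hvec_rvec !scalerA mulrC addvv2.
Qed.

Lemma jacobiator_h a x y : jacobiator (hvec a) x y = 0.
Proof.
elim/model_ind: x => [x x' Jx Jx'|c x Jx|b|v rv].
- by rewrite jacobiator_rot jacobiatorD -!(jacobiator_rot (hvec a)) Jx Jx' addr0.
- by rewrite jacobiator_rot jacobiatorZ -!(jacobiator_rot (hvec a)) Jx scaler0.
- exact: jacobiator_hh.
elim/model_ind: y => [y y' Jy Jy'|c y Jy|b|w rw].
- by rewrite -jacobiator_rot jacobiatorD !(jacobiator_rot _ (hvec a)) Jy Jy' addr0.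
- by rewrite -jacobiator_rot jacobiatorZ !(jacobiator_rot _ (hvec a)) Jy scaler0.
- by rewrite -jacobiator_rot jacobiator_hh.
rewrite /jacobiator [mbr _ (hvec a)]mbrC !mbr_hvec_rvec !mbrZr.
rewrite [mbr (rvec w) _]mbrC -addrA -scalerDl [eigen a w + _]addrC -eigenD.
rewrite mbr_rvec // mbrDr mbrZr mbr_hvec scaler0 addr0 mbr_hvec_rvec.
rewrite scalerDr addrA addvv2 // add0r.
by case: eqP => [->|_]; rewrite ?eigen0 ?scale0r ?scaler0.
Qed.

Lemma mbr_rvec3 u v w : is_root u -> is_root v -> is_root w ->
  mbr (rvec u) (mbr (rvec v) (rvec w)) =
    (lform v w == -1)%:R *: (rvec (u + v + w) + (u + v + w == 0)%:R *: coroot u)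
    + (v + w == 0)%:R *: ((lform v u)%:~R *: rvec u).
Proof.
move=> ru rv rw; rewrite [mbr (rvec v) _]mbr_rvec // mbrC mbrDl mbrZl.
rewrite mbr_hvec_rvec eigen_coroot (mbr_rvec_gen _ ru) (root_add rv rw).
by rewrite [v + w + u]addrC addrA.
Qed.

(** With k = (v, u), the coefficient of x_u is k, plus 1 if k = 1, plus 1 if k = -1. As |k| is at
    most 2, k is odd exactly when it is 1 or -1, so the sum is even. The extra terms for u = v and u
    = -v have the coefficients 2 and -2. *)
Lemma root_cycle u v w : is_root u -> is_root v -> is_root w -> v + w = 0 ->
  jacobiator (rvec u) (rvec v) (rvec w) = 0.
Proof.
move=> ru rv rw vw; have wv : w = - v by apply/eqP; rewrite -addr_eq0 addrC vw.
have s1 : u + v + w = u by rewrite -addrA vw addr0.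
have s2 : v + w + u = u by rewrite vw add0r.
have s3 : w + u + v = u by rewrite addrAC [w + v]addrC vw add0r.
rewrite /jacobiator (mbr_rvec3 ru rv rw) (mbr_rvec3 rv rw ru) (mbr_rvec3 rw ru rv) s1 s2 s3
  (negPf (root_neq0 ru)) vw eqxx !scale0r scale1r !addr0.
rewrite !(root_opp qpos) // wv !(lformNl, lformNr) (lformC U u v) (root_diag rv).
rewrite (_ : - 2 == -1 = false) // scale0r add0r.
set k := lform v u.
have k2 : -2 <= k <= 2 by rewrite root_form_ge ?root_form_le.
have -> : (- k == -2)%:R *: (((- 2 : int)%:~R : K) *: rvec v) = 0.
  by rewrite int_pchar2 /= scale0r scaler0.
have -> : (k == -2)%:R *: ((- k)%:~R *: rvec (- v)) = 0.
  by case: eqP => [->|]; rewrite ?scale0r // opprK (int_pchar2 2) scale0r scaler0.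
rewrite !addr0 -!scalerDl int_pchar2 !natb_addb.
suff -> : (odd `|k| (+) (- k == -1) (+) (k == -1)) = false by rewrite scale0r.
by move: k2; clear; move: k => k; lia.
Qed.

Lemma jacobiator_rvec u v w : is_root u -> is_root v -> is_root w ->
  jacobiator (rvec u) (rvec v) (rvec w) = 0.
Proof.
move=> ru rv rw.
case: (eqVneq (v + w) 0) => [vw|vw]; first exact: root_cycle.
case: (eqVneq (w + u) 0) => [wu|wu]; first by rewrite jacobiator_rot; exact: root_cycle.
case: (eqVneq (u + v) 0) => [uv|uv].
  by rewrite jacobiator_rot jacobiator_rot; exact: root_cycle.
rewrite /jacobiator (mbr_rvec3 ru rv rw) (mbr_rvec3 rv rw ru) (mbr_rvec3 rw ru rv) (negPf
  vw) (negPf wu) (negPf uv) !scale0r !addr0.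
have s2 : v + w + u = u + v + w by rewrite addrC addrA.
have s3 : w + u + v = u + v + w by rewrite -addrA addrC.
rewrite s2 s3; case: (eqVneq (u + v + w) 0) => s0.
  (* Pairing u + v + w = 0 with u, v and w makes all three products -1; what remains is the coroot
     h_u + h_v + h_w of the sum, which is 0. *)
  have form0 (x : 'rV_n) : lform u x + lform v x + lform w x = 0.
    by rewrite -!lformDl s0 lformC lform0r.
  have [fu fv fw] := And3 (form0 u) (form0 v) (form0 w).
  move: fu fv fw; rewrite !root_diag // (lformC _ v u) (lformC _ w u) (lformC _ w v) =>
    fu fv fw.
  have -> : lform v w = -1 by lia.
  have -> : lform u w = -1 by lia.
  have -> : lform u v = -1 by lia.
  rewrite s0 rvec_nroot ?is_root0 // !add0r !scale1r -!corootD s0.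
  exact: coroot0.
rewrite !scale0r !addr0 -!scalerDl !natb_addb (lformC _ w u).
case: (boolP (is_root (u + v + w))) => [|/rvec_nroot -> ]; last by rewrite scaler0.
(* From 1 = q(u + v + w) = 3 + (u, v) + (u, w) + (v, w) the products add up to -2. No two of the
   roots are opposite, so each product is at least -1: two are -1 and the third is 0. *)
rewrite {1}/is_root !qformD lformDl (eqP ru) (eqP rv) (eqP rw) => /eqP rs.
suff -> : (lform v w == -1) (+) (lform u w == -1) (+) (lform u v == -1)
  = false by rewrite scale0r.
move: vw wu uv; rewrite !(root_opp qpos) // (lformC _ w u).
have := root_form_le qpos rv rw; have := root_form_le qpos ru rw;
  have := root_form_le qpos ru rv.
have := root_form_ge qpos rv rw; have := root_form_ge qpos ru rw;
  have := root_form_ge qpos ru rv.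
have neq2 (x y z : 'rV_n) : is_root x -> is_root y -> lform x y = 2 -> lform x z = lform y z.
  by move=> rx ry xy; congr (lform _ z); apply/eqP; rewrite (root_eq qpos) // xy.
have := neq2 u v w ru rv; have := neq2 u w v ru rw; have := neq2 v w u rv rw.
rewrite (lformC _ w v) (lformC _ v u) (lformC _ w u).
move: rs; move: (lform v w) (lform u w) (lform u v); clear => x y z; lia.
Qed.

Lemma mbr_jacobi x y z : jacobiator x y z = 0.
Proof.
elim/model_ind: x => [x x' Jx Jx'|c x Jx|a|u ru]; last 1 first; last exact: jacobiator_h.
- elim/model_ind: y => [y y' Jy Jy'|c y Jy|a|v rv].
  + by rewrite jacobiator_rot jacobiatorD -!(jacobiator_rot (rvec u)) Jy Jy' addr0.
  + by rewrite jacobiator_rot jacobiatorZ -!(jacobiator_rot (rvec u)) Jy scaler0.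
  + by rewrite jacobiator_rot jacobiator_h.
  elim/model_ind: z => [z z' Jz Jz'|c z Jz|a|w rw].
  + by rewrite -jacobiator_rot jacobiatorD !(jacobiator_rot _ (rvec u)) Jz Jz' addr0.
  + by rewrite -jacobiator_rot jacobiatorZ !(jacobiator_rot _ (rvec u)) Jz scaler0.
  + by rewrite -jacobiator_rot jacobiator_h.
  + exact: jacobiator_rvec.
- by rewrite jacobiatorD Jx Jx' addr0.
- by rewrite jacobiatorZ Jx scaler0.
Qed.

Definition parity (b : basis) : bool :=
  if b is inr r then weight_parity p (ssval r) else false.

Definition modd x : M := [ffun b => if parity b then x b else 0].

Lemma moddD x y : modd (x + y) = modd x + modd y.
Proof. by apply/ffunP => b; rewrite !ffunE; case: ifP => _ //; rewrite addr0. Qed.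

Lemma moddZ c x : modd (c *: x) = c *: modd x.
Proof. by apply/ffunP => b; rewrite !ffunE; case: ifP => _ //; rewrite scaler0. Qed.

Lemma modd0 : modd 0 = 0.
Proof. by apply/ffunP => b; rewrite !ffunE; case: ifP. Qed.

Lemma modd_idem x : modd (modd x) = modd x.
Proof. by apply/ffunP => b; rewrite !ffunE; case: (parity b). Qed.

Lemma modd_hvec a : modd (hvec a) = 0.
Proof. by apply/ffunP => -[j|r]; rewrite !ffunE //=; case: ifP. Qed.

Lemma modd_rvec v : modd (rvec v) = (weight_parity p v)%:R *: rvec v.
Proof.
apply/ffunP => -[j|r]; rewrite !ffunE ?scaler0 //=.
by case: eqP => [->|_]; case: ifP => _; rewrite ?scale1r ?scale0r ?scaler0.
Qed.

Lemma modd_br_rvec v w : is_root v -> is_root w ->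
  modd (mbr (rvec v) (rvec w)) =
    (weight_parity p v (+) weight_parity p w)%:R *: mbr (rvec v) (rvec w).
Proof.
move=> rv rw; rewrite mbr_rvec // moddD moddZ modd_rvec modd_hvec scaler0 addr0.
rewrite weight_parityD; case: eqP => [vw|_]; last by rewrite scale0r addr0.
have -> : w = - v by apply/eqP; rewrite -addr_eq0 addrC vw.
by rewrite weight_parityN addbb !scale0r.
Qed.

Lemma modd_br x y : modd (mbr x y) = mbr (modd x) (y - modd y) + mbr (x - modd x) (modd y).
Proof.
rewrite !(oppv2 charK2).
elim/model_ind: x => [x x' IH IH'|c x IH|a|v rv].
- by rewrite mbrDl !moddD IH IH' addrACA (addrACA x) -!mbrDl.
- by rewrite mbrZl !moddZ IH -scalerDr !mbrZl -scalerDr.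
- rewrite modd_hvec mbr0l add0r addr0.
  elim/model_ind: y => [y y' IH IH'|c y IH|b|w rw].
  + by rewrite !(moddD, mbrDr) IH IH'.
  + by rewrite !(moddZ, mbrZr) IH.
  + by rewrite modd_hvec mbr0r mbr_hvec modd0.
  + by rewrite mbr_hvec_rvec moddZ modd_rvec mbrZr mbr_hvec_rvec !scalerA mulrC.
elim/model_ind: y => [y y' IH IH'|c y IH|b|w rw].
- by rewrite mbrDr !moddD IH IH' addrACA (addrACA y) -!mbrDr.
- by rewrite mbrZr !moddZ IH -scalerDr !mbrZr -scalerDr.
- rewrite modd_hvec mbr0r !addr0 mbrC mbr_hvec_rvec moddZ modd_rvec mbrZl [in RHS]mbrC.
  by rewrite mbr_hvec_rvec !scalerA mulrC.
rewrite modd_br_rvec // !modd_rvec; do 2!case: (weight_parity p _);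
  by rewrite /= ?scale1r ?scale0r ?addr0 ?addvv2 ?mbr0l ?mbr0r ?addr0 ?add0r.
Qed.

(** The quadratic map that is zero on the basis and has the bracket of odd parts as polar form;
    [enum_rank] only orders the basis, so that each unordered pair counts once. *)
Definition msq x : M :=
  \sum_b \sum_(c | (enum_rank b < enum_rank c)%N) (modd x b * modd x c) *: bracket_table b c.

Lemma bracket_table_diag b : bracket_table b b = 0.
Proof.
case: b => [//|r] /=; have rr : is_root (ssval r) by rewrite -rootsE ssvalP.
rewrite (root_opp qpos) // root_diag // scale0r addr0 rvec_nroot // root_add //.
by rewrite root_diag.
Qed.

(** The table is symmetric with zero diagonal, so the bracket can be collected over unordered pairs,
    the shape of [msq]. *)
Lemma mbr_split x y : mbr x y =
  \sum_b \sum_(c | (enum_rank b < enum_rank c)%N) (x b * y c + y b * x c) *: bracket_table b c.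
Proof.
have -> : mbr x y = \sum_b \sum_(c | (enum_rank b < enum_rank c)%N) (x b * y c) *:
  bracket_table b c
    + \sum_b \sum_(c | (enum_rank c < enum_rank b)%N) (x b * y c) *: bracket_table b c.
  rewrite -big_split; apply: eq_bigr => b _; rewrite [X in _ = X + _]big_mkcond.
  rewrite [X in _ = _ + X]big_mkcond -big_split.
  apply: eq_bigr => c _ /=; case: ltngtP => [_|_|bc]; rewrite ?addr0 ?add0r //.
  by rewrite (enum_rank_inj (val_inj bc)) bracket_table_diag scaler0.
rewrite [X in _ + X](exchange_big_dep xpredT) //= -big_split; apply: eq_bigr => b _.
rewrite -big_split; apply: eq_bigr => c _.
by rewrite scalerDl [y b * _]mulrC [bracket_table c b]bracket_tableC.
Qed.

Lemma msq_polar x y : mbr (modd x) (modd y) = msq (x + y) - msq x - msq y.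
Proof.
apply/eqP; rewrite eq_sym !subr_eq /msq mbr_split -!big_split; apply/eqP/eq_bigr => b _.
rewrite -!big_split; apply: eq_bigr => c _; rewrite /= -!scalerDl moddD !ffunE; congr (_ *: _).
by rewrite mulrDl !mulrDr [RHS]addrC !addrA.
Qed.

Lemma msqD x y : msq (x + y) = msq x + msq y + mbr (modd x) (modd y).
Proof. by rewrite msq_polar -(addrA (msq (x + y))) -opprD [RHS]addrC subrK. Qed.

Lemma msqZ c x : msq (c *: x) = c ^+ 2 *: msq x.
Proof.
rewrite /msq scaler_sumr; apply: eq_bigr => b _; rewrite scaler_sumr; apply: eq_bigr => d _.
by rewrite moddZ !ffunE scalerA mulrACA -expr2.
Qed.

Lemma msq_mod x : msq (modd x) = msq x.
Proof. by rewrite /msq modd_idem. Qed.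

Lemma msq_hvec a : msq (hvec a) = 0.
Proof.
by rewrite -msq_mod modd_hvec -(scale0r (hvec a)) msqZ expr2 mul0r !scale0r.
Qed.

Lemma msq_rvec v : msq (rvec v) = 0.
Proof.
have modE d : modd (rvec v) d = (weight_parity p v)%:R * rvec v d by rewrite modd_rvec ffunE.
rewrite /msq big1 // => b _; rewrite big1 // => c bc; rewrite !modE mulrACA.
suff -> : rvec v b * rvec v c = 0 by rewrite mulr0 scale0r.
rewrite !ffunE; case: b c bc => [i|r] [j|s] rs; rewrite ?mul0r ?mulr0 //.
case: eqP rs => [->|]; rewrite ?mul0r // mul1r.
by case: eqP => // /val_inj ->; rewrite ltnn.
Qed.

Lemma modd_msq x : modd (msq x) = 0.
Proof.
elim/model_ind: x => [x y IHx IHy|c x IH|a|v rv].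
- rewrite msqD !moddD IHx IHy !add0r modd_br !modd_idem !subrr mbr0l mbr0r addr0 //.
- by rewrite msqZ moddZ IH scaler0.
- by rewrite msq_hvec modd0.
- by rewrite msq_rvec modd0.
Qed.

Lemma mbr_deriv x y z : mbr (mbr x y) z = mbr x (mbr y z) + mbr y (mbr x z).
Proof.
apply/eqP; rewrite -subr_eq0 (oppv2 charK2) addrC [mbr (mbr _ _) _]mbrC [mbr x z]mbrC.
exact/eqP/mbr_jacobi.
Qed.

(** This makes x_v^2 = 0 consistent with the bracket. On x_(-v) the result has the coefficient (v,
    v) = 2 = 0; if (v, w) = -1, then q(2v + w) = 3, so 2v + w is neither a root nor zero. *)
Lemma mbr_rvec2 v y : is_root v -> mbr (rvec v) (mbr (rvec v) y) = 0.
Proof.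
move=> rv; elim/model_ind: y => [y y' IH IH'|c y IH|b|w rw].
- by rewrite !mbrDr IH IH' addr0.
- by rewrite !mbrZr IH scaler0.
- by rewrite [mbr _ (hvec b)]mbrC mbr_hvec_rvec mbrZr mbr_alt scaler0.
rewrite (mbr_rvec3 rv rv rw) (root_diag rv) (int_pchar2 2) scale0r scaler0 addr0.
case: eqP => [vw|_]; last by rewrite scale0r.
have q3 : qform U (v + v + w) = 3 :> int.
  by rewrite !qformD lformDl (root_diag rv) vw (eqP rv) (eqP rw).
rewrite rvec_nroot ?/is_root ?q3 // add0r.
by case: eqP => [s0|_]; rewrite ?scale0r ?scaler0 //; move: q3; rewrite s0 qform0.
Qed.

Lemma mbr_msq x y : mbr (msq x) y = mbr (modd x) (mbr (modd x) y).
Proof.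
elim/model_ind: x y => [x x' IH IH' y|c x IH y|a y|v rv y].
- rewrite msqD !mbrDl IH IH' mbr_deriv moddD !mbrDl !mbrDr.
  by rewrite -!addrA [X in _ + X = _]addrC -!addrA.
- by rewrite msqZ moddZ !mbrZl mbrZr IH scalerA expr2.
- by rewrite msq_hvec modd_hvec !mbr0l.
- by rewrite msq_rvec modd_rvec mbr0l !mbrZl mbrZr mbr_rvec2 // !scaler0.
Qed.

Lemma model_is_lie : is_lieSuper modd mbr msq.
Proof.
split.
- by move=> c x y; rewrite moddD moddZ.
- exact: modd_idem.
- by move=> z c x y /=; rewrite mbrDl mbrZl.
- by move=> z c x y; rewrite mbrDr mbrZr.
- exact: mbr_alt.
- exact: mbr_jacobi.
- exact: modd_br.
- exact: msq_mod.
- exact: modd_msq.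
- exact: msqZ.
- exact: msq_polar.
- exact: mbr_msq.
Qed.

Definition model_lie : lieSuper K := LieSuper model_is_lie.
End Model.

(** * The contragredient algebra is the model *)

Section ContragredientModel.
Variables (n : nat) (U : 'M[int]_n) (roots : seq 'rV[int]_n).
Hypothesis qpos : posdef U.
Hypothesis rootsE : forall v, (v \in roots) = is_root U v.
Hypothesis diagU : forall i, U i i = 1.
Hypothesis offdiagU : forall i j, i != j -> (U + U^T) i j <= 0.
Variables (K : fieldType) (charK2 : 2%N \in [pchar K]) (p : 'I_n -> bool).
Implicit Types v w d : 'rV[int]_n.

Local Notation lform := (lform U).
Local Notation is_root := (is_root U).
Local Notation M := (model_lie qpos rootsE charK2 p).
Local Notation cartan := (map_mx intr (U + U^T) : 'M[K]_n).
Local Notation simple j := (delta_mx 0 j : 'rV[int]_n).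
Local Notation hvec := (hvec roots).
Local Notation rvec := (rvec roots K).
Local Notation mbr := (mbr U).
Implicit Types (x y z : M).

Definition model_gen (s : generator n) : M :=
  match s with
  | H j => hvec (delta_mx 0 j)
  | X j => rvec (simple j)
  | Y j => rvec (- simple j)
  end.

Lemma eigen_delta j v : eigen U (delta_mx 0 j) v = (lform (simple j) v)%:~R :> K.
Proof.
rewrite /eigen (bigD1 j) //= big1 => [|k /negPf kj]; rewrite mxE ?eqxx ?kj ?mul0r //.
by rewrite mul1r addr0.
Qed.

Lemma model_relations : cartan_relations cartan p model_gen.
Proof.
split=> [j|j|j|i j|i j|i j|i j]; rewrite /has_parity /=.
- exact: modd_hvec.
- by rewrite [LHS]modd_rvec weight_parity_simple; case: (p j); rewrite ?scale1r ?scale0r.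
- rewrite [LHS]modd_rvec weight_parityN weight_parity_simple.
  by case: (p j); rewrite ?scale1r ?scale0r.
- exact: mbr_hvec.
- by rewrite [LHS]mbr_hvec_rvec // eigen_delta lform_simple [in RHS]mxE.
- by rewrite [LHS]mbr_hvec_rvec // eigen_delta lformNr lform_simple [in RHS]mxE rmorphN.
rewrite [LHS]mbr_rvec ?is_rootN ?(root_simple diagU) //.
have [->|ij] := eqVneq i j.
  rewrite subrr eqxx scale1r (rvec_nroot rootsE) ?is_root0 // add0r /coroot.
  by rewrite map_delta_mx.
(* A product that is not negative excludes -1 and -2: the difference of two simple roots is neither
   a root nor zero. *)
have fij : 0 <= lform (simple i) (- simple j).
  by rewrite lformNr lform_simple oppr_ge0 offdiagU.
rewrite (rvec_nroot rootsE) ?(root_opp qpos) ?root_add ?is_rootN ?(root_simple diagU) //;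
  last first.
  by move: fij; case: eqP => // ->.
by rewrite add0r; case: eqP fij => [->|]; rewrite ?scale0r.
Qed.

Lemma hvec_sum (a : 'rV[K]_n) : hvec a = \sum_j a 0 j *: hvec (delta_mx 0 j).
Proof.
rewrite [a in LHS]row_sum_delta; elim/big_rec2: _ => [|j x y _ <-].
  by apply/ffunP => -[i|r]; rewrite !ffunE ?mxE.
by rewrite hvecD hvecZ.
Qed.

Lemma rvecD v w : is_root v -> is_root w -> is_root (v + w) ->
  rvec (v + w) = mbr (rvec v) (rvec w).
Proof.
by move=> rv rw rvw; rewrite mbr_rvec // (negPf (root_neq0 rvw)) scale0r addr0.
Qed.

(** The x_j and y_j generate M as a Lie algebra: h_j = [x_j, y_j], and [root_ind] supplies the other
    root vectors. *)
Lemma model_gen_ind (P : M -> Prop) : P 0 ->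
  (forall x y, P x -> P y -> P (x + y)) -> (forall c x, P x -> P (c *: x)) ->
  (forall x y, P x -> P y -> P (br x y)) ->
  (forall j, P (model_gen (X j))) -> (forall j, P (model_gen (Y j))) ->
  forall x, P x.
Proof.
move=> P0 PD PZ Pb PX PY.
have Pr : forall v, is_root v -> P (rvec v).
  apply: (root_ind qpos diagU) => // v w rv rw rvw Pv Pw; rewrite rvecD //; exact: Pb.
apply: (model_ind rootsE) => // a; rewrite hvec_sum.
elim/big_ind: _ => // j _; apply: PZ; have := Pb _ _ (PX j) (PY j).
by rewrite (rel_xy model_relations) eqxx.
Qed.

Lemma coroot_neq0 v : is_root v -> coroot roots K v != 0.
Proof.
move=> /root_odd [k vk]; apply/eqP => /ffunP /(_ (inl k)) /eqP.
by rewrite !ffunE mxE (int_pchar2 charK2) vk oner_eq0.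
Qed.

Definition degree (b : 'I_n + seq_sub roots) : 'rV[int]_n :=
  if b is inr r then ssval r else 0.

(** A condition on the support, unlike the inductive [homogeneous]: elements of different degrees
    have disjoint supports. *)
Definition of_degree d (x : M) := forall b, x b != 0 -> degree b = d.

Lemma of_degree0 d : of_degree d 0.
Proof. by move=> b; rewrite ffunE eqxx. Qed.

Lemma of_degreeD d x y : of_degree d x -> of_degree d y -> of_degree d (x + y).
Proof.
move=> dx dy b; rewrite ffunE; case: (eqVneq (x b) 0) => [->|/dx//].
by rewrite add0r => /dy.
Qed.

Lemma of_degreeZ d c x : of_degree d x -> of_degree d (c *: x).
Proof. by move=> dx b; rewrite ffunE mulf_eq0 negb_or => /andP[_ /dx]. Qed.

Lemma of_degree_rvec v : of_degree v (rvec v).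
Proof. by move=> [j|r]; rewrite ffunE ?eqxx //=; case: (v =P _) => [->|]; rewrite ?eqxx. Qed.

Lemma of_degree_hvec (a : 'rV[K]_n) : of_degree 0 (hvec a).
Proof. by move=> [j|r]; rewrite ffunE ?eqxx. Qed.

Lemma of_degree_table b c : of_degree (degree b + degree c) (bracket_table U K b c).
Proof.
case: b c => [i|r] [j|s] /=; rewrite ?add0r ?addr0.
- exact: of_degree0.
- exact/of_degreeZ/of_degree_rvec.
- exact/of_degreeZ/of_degree_rvec.
- apply: of_degreeD; first exact: of_degree_rvec.
  case: eqP => [->|_]; first exact/of_degreeZ/of_degree_hvec.
  by rewrite scale0r; exact: of_degree0.
Qed.

Lemma of_degree_sum (I : Type) (r : seq I) (P : pred I) (F : I -> M) d :
  (forall i, P i -> of_degree d (F i)) -> of_degree d (\sum_(i <- r | P i) F i).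
Proof.
move=> dF; elim/big_ind: _ => //; [exact: of_degree0 | by move=> x y; exact: of_degreeD].
Qed.

Lemma of_degree_coef d e x y b c : of_degree d x -> of_degree e y ->
  of_degree (d + e) ((x b * y c) *: bracket_table U K b c).
Proof.
move=> dx ey; case: (eqVneq (x b) 0) => [->|/dx <-].
  by rewrite mul0r scale0r; exact: of_degree0.
case: (eqVneq (y c) 0) => [->|/ey <-].
  by rewrite mulr0 scale0r; exact: of_degree0.
exact/of_degreeZ/of_degree_table.
Qed.

Lemma homogeneous_of_degree d x : homogeneous model_gen d x -> of_degree d x.
Proof.
elim=> {d x} [j|j|j|d|d x y _ IHx _ IHy|d c x _ IHx|d e x y _ IHx _ IHy|d x _ IHx].
- exact: of_degree_hvec.
- exact: of_degree_rvec.
- exact: of_degree_rvec.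
- exact: of_degree0.
- exact: of_degreeD.
- exact: of_degreeZ.
- by do 2!apply: of_degree_sum => ? _; exact: of_degree_coef.
- rewrite mulr2n; do 2!apply: of_degree_sum => ? _; apply: of_degree_coef.
  all: by move=> b; rewrite ffunE; case: ifP => _; rewrite ?eqxx //; exact: IHx.
Qed.

Lemma of_degree_root d x : is_root d -> of_degree d x -> exists c, x = c *: rvec d.
Proof.
move=> rd dx; have rd' : d \in roots by rewrite rootsE.
exists (x (inr (SeqSub rd'))); apply/ffunP => -[j|r]; rewrite !ffunE.
  rewrite scaler0; apply/eqP; apply: contraLR rd => /dx <-.
  by rewrite is_root0.
case: eqP => [dr|/eqP dr].
  rewrite /GRing.scale /= mulr1; congr (x (inr _)); exact: val_inj.
by rewrite scaler0; apply/eqP; apply: contraNT dr => /dx /= ->.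
Qed.

Lemma of_degree_nroot d x : d != 0 -> ~~ is_root d -> of_degree d x -> x = 0.
Proof.
move=> d0 rd dx; apply/ffunP => b; rewrite ffunE; apply/eqP; apply: contraNT rd => /dx.
case: b => [j|r] /= dE; first by rewrite -dE eqxx in d0.
by rewrite -dE -rootsE ssvalP.
Qed.

Local Notation G := (gtilde cartan p).
Local Notation ggen := (@gtilde_gen K n cartan p).
Implicit Types s t : G.

Definition ev t : M := eval model_gen (rep t).

Lemma ev_cls (t : term K n) : ev (cls cartan p t) = eval model_gen t.
Proof. exact: (eval_rep _ model_relations). Qed.

Lemma evD s t : ev (s + t) = ev s + ev t. Proof. exact: ev_cls. Qed.
Lemma evZ c t : ev (c *: t) = c *: ev t. Proof. exact: ev_cls. Qed.
Lemma ev_od t : ev (od t) = od (ev t). Proof. exact: ev_cls. Qed.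
Lemma ev_br s t : ev (br s t) = br (ev s) (ev t). Proof. exact: ev_cls. Qed.
Lemma ev_sq t : ev (sq t) = sq (ev t). Proof. exact: ev_cls. Qed.
Lemma ev0 : ev 0 = 0. Proof. exact: ev_cls. Qed.
Lemma ev_gen g : ev (ggen g) = model_gen g. Proof. exact: ev_cls. Qed.

Lemma ev_sum (I : Type) (r : seq I) (P : pred I) (F : I -> G) :
  ev (\sum_(i <- r | P i) F i) = \sum_(i <- r | P i) ev (F i).
Proof. exact: (big_morph ev evD ev0). Qed.

Lemma ev_homogeneous d t : homogeneous ggen d t -> homogeneous model_gen d (ev t).
Proof.
elim=> {d t} [j|j|j|d|d s t _ IHs _ IHt|d c t _ IHt|d e s t _ IHs _ IHt|d t _ IHt].
- by rewrite ev_gen; exact: hom_h.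
- by rewrite ev_gen; exact: hom_x.
- by rewrite ev_gen; exact: hom_y.
- by rewrite ev0; exact: hom_0.
- by rewrite evD; exact: hom_add.
- by rewrite evZ; exact: hom_scale.
- by rewrite ev_br; exact: hom_br.
- by rewrite ev_sq; exact: hom_sq.
Qed.

Lemma ev_surj x : exists t, ev t = x.
Proof.
move: x; apply: model_gen_ind => [|_ _ [s <-] [t <-]|c _ [t <-]|_ _ [s <-] [t <-]|j|j].
- by exists 0; exact: ev0.
- by exists (s + t); exact: evD.
- by exists (c *: t); exact: evZ.
- by exists (br s t); exact: ev_br.
- by exists (ggen (X j)); exact: ev_gen.
- by exists (ggen (Y j)); exact: ev_gen.
Qed.

Lemma lift_rvec v : is_root v -> exists2 t, homogeneous ggen v t & ev t = rvec v.
Proof.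
move: v; apply: (root_ind qpos diagU) => [j|j|v w rv rw rvw [s hs es] [t ht et]].
- by exists (ggen (X j)); [exact: hom_x | exact: ev_gen].
- by exists (ggen (Y j)); [exact: hom_y | exact: ev_gen].
- exists (br s t); first exact: hom_br.
  by rewrite ev_br es et rvecD.
Qed.

Definition ev_kernel t := ev t = 0.

Lemma ev_kernel_ideal : lie_ideal ev_kernel.
Proof.
split=> [|s t s0 t0|c t t0|t t0|s t t0|t t0]; rewrite /ev_kernel.
- exact: ev0.
- by rewrite evD s0 t0 addr0.
- by rewrite evZ t0 scaler0.
- by rewrite ev_od t0 od0.
- by rewrite ev_br t0 br0r.
- by rewrite ev_sq t0 sq0.
Qed.

Lemma ev_kernel_graded : graded ggen ev_kernel.
Proof.
move=> t t0.
have [ds [F [ds_uniq tF hF]]] : exists (ds : seq 'rV[int]_n) (F : 'rV[int]_n -> G),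
    [/\ uniq ds, t = \sum_(d <- ds) F d & forall d, homogeneous ggen d (F d)].
  apply: homogeneous_components; rewrite -[t](repK).
  have := homogeneous_span_eval (gtilde_relations cartan p) (rep t).
  by rewrite eval_gtilde.
exists [seq F d | d <- ds]; split=> [|w /mapP[d dsd ->]]; first by rewrite big_map.
split; last by exists d.
have degF e : of_degree e (ev (F e)) by exact/homogeneous_of_degree/ev_homogeneous.
(* At a basis element in the support of the component of degree d all other components vanish, so
   nothing can cancel it. *)
apply/ffunP => b; rewrite ffunE; apply/eqP; apply: contraT => b0.
move: (t0); rewrite /ev_kernel tF ev_sum (bigD1_seq d) //= => /ffunP/(_ b).
rewrite [LHS]ffunE sum_ffunE big1 => [|e ed].
  by rewrite addr0 ffunE => b00; rewrite b00 eqxx in b0.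
by apply/eqP; apply: contraNT ed => /degF <-; rewrite (degF d).
Qed.

Lemma ev_kernel_span_h t : ev_kernel t -> span_h ggen t -> t = 0.
Proof.
move=> + [a ta]; rewrite /ev_kernel {1}ta ev_sum => h0.
rewrite ta big1 // => j _; suff -> : a j = 0 by rewrite scale0r.
move/ffunP: h0 => /(_ (inl j)); rewrite sum_ffunE [RHS]ffunE (bigD1 j) //= big1 => [|i ij].
  by rewrite evZ ev_gen !ffunE mxE !eqxx addr0 => <-; rewrite [RHS]mulr1.
by rewrite evZ ev_gen !ffunE mxE [_ == i]eq_sym (negPf ij) scaler0.
Qed.

(** Bracketing a component of root degree d with a lift of x_(-d) brings it into degree 0 without
    leaving J, so the bracket is 0; its image is c times a nonzero coroot, hence c = 0. The model
    has no elements of other nonzero degrees. *)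
Lemma graded_ideal_ev_kernel (J : G -> Prop) : lie_ideal J -> graded ggen J ->
  (forall u, J u -> span_h ggen u -> u = 0) -> forall t, J t -> ev_kernel t.
Proof.
move=> idJ grJ J0 t /grJ [ws [-> Jws]]; rewrite /ev_kernel ev_sum big_seq big1 // =>
  w /Jws [Jw [d hw]].
have rel := gtilde_relations cartan p.
have dw : of_degree d (ev w) by exact/homogeneous_of_degree/ev_homogeneous.
case: (eqVneq d 0) => [d0|d0].
  rewrite (J0 w) ?ev0 //; apply: (homogeneous0_span_h charK2 rel).
  by rewrite -d0.
case: (boolP (is_root d)) => rd; last exact: of_degree_nroot dw.
have [c wc] := of_degree_root rd dw.
have [u hu eu] : exists2 t, homogeneous ggen (- d) t & ev t = rvec (- d).
  by apply: lift_rvec; rewrite is_rootN.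
have : ev (br u w) = 0.
  rewrite (J0 (br u w)) ?ev0 //; first exact: (ideal_br idJ).
  by apply: (homogeneous0_span_h charK2 rel); rewrite -(addNr d); exact: hom_br.
rewrite ev_br eu wc brZr [br _ _]mbr_rvec ?is_rootN // addNr (rvec_nroot rootsE) ?is_root0 //.
rewrite add0r eqxx scale1r => /eqP; rewrite scaler_eq0 (negPf (coroot_neq0 _)) ?is_rootN //
  orbF.
by move=> /eqP ->; rewrite scale0r.
Qed.

Lemma max_idealE t : max_ideal ggen t <-> ev_kernel t.
Proof.
split=> [mt|kt I _ JI]; first exact: mt ev_kernel_ideal graded_ideal_ev_kernel.
by apply: JI kt; [exact: ev_kernel_ideal | exact: ev_kernel_graded | exact: ev_kernel_span_h].
Qed.

Local Notation L := (contragredient cartan p).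
Local Notation to_L := (to_quot (max_ideal_ideal ggen)).

Definition model_of (q : L) : M := ev (of_quot q).

Lemma model_of_quot t : model_of (to_L t) = ev t.
Proof.
have /max_idealE := of_quotP (max_ideal_ideal ggen) t.
rewrite /ev_kernel /model_of -scaleN1r evD evZ scaleN1r => /eqP.
by rewrite subr_eq0 => /eqP.
Qed.

Lemma model_of_linear : linear model_of.
Proof.
move=> c; elim/qind => s; elim/qind => t.
by rewrite -to_quotZ -to_quotD !model_of_quot evD evZ.
Qed.

Lemma model_of_br (q r : L) : model_of (br q r) = br (model_of q) (model_of r).
Proof.
elim/qind: q => s; elim/qind: r => t.
have -> : @br K L (to_L s) (to_L t) = to_L (br s t) by exact: qbrE.
by rewrite !model_of_quot ev_br.
Qed.

Lemma model_of_inj : injective model_of.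
Proof.
elim/qind => s; elim/qind => t; rewrite !model_of_quot => st.
by apply/to_quotP/max_idealE; rewrite /ev_kernel -scaleN1r evD evZ st scaleN1r subrr.
Qed.

Lemma model_of_surj x : exists q, model_of q = x.
Proof. by have [t <-] := ev_surj x; exists (to_L t); exact: model_of_quot. Qed.

Lemma chevalley_relations : cartan_relations cartan p (@chevalley K n cartan p).
Proof.
have [h1 h2 h3 h4 h5 h6 h7] := gtilde_relations cartan p.
have lift := (@qodE _ _ _ (max_ideal_ideal ggen), @qbrE _ _ _ (max_ideal_ideal ggen),
  =^~ @to_quotZ _ _ _ (max_ideal_ideal ggen)).
split=> [j|j|j|i j|i j|i j|i j]; rewrite /has_parity /chevalley /=.
- by rewrite lift h1.
- by rewrite lift h2; case: (p j).
- by rewrite lift h3; case: (p j).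
- by rewrite lift h4.
- by rewrite !lift h5.
- by rewrite !lift h6.
- by rewrite lift h7; case: (i == j).
Qed.

End ContragredientModel.

(** * Derivations and cocycles *)

Section LieCocycles.
Variables (K : fieldType) (charK2 : 2%N \in [pchar K]) (L : lieSuper K).

Definition lie_derivation (D : L -> L) : Prop :=
  linear D /\ forall u v, D (br u v) = br (D u) v + br u (D v).

Definition lie_cocycle (c : L -> L -> K^o) : Prop :=
  [/\ forall v, scalar (c v), forall v, scalar (c^~ v), forall u, c u u = 0
    & forall u v w, c (br u v) w + c (br v w) u + c (br w u) v = 0].

Lemma lie_derivation_subr D z : lie_derivation D -> lie_derivation (fun u => D u + br z u).
Proof.
move=> [Dlin Dbr]; split=> [a u v|u v].
  by rewrite Dlin brDr brZr scalerDr addrACA.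
by rewrite Dbr br_derivr // brDl brDr addrACA.
Qed.

Section Cocycle.
Variables (c : L -> L -> K^o) (cc : lie_cocycle c).

Lemma cocycleDl u v w : c (u + v) w = c u w + c v w.
Proof. by case: cc => _ lin _ _; have /= := lin w 1 u v; rewrite scale1r mul1r. Qed.

Lemma cocycle0l w : c 0 w = 0.
Proof. by apply: (addrI (c 0 w)); rewrite -cocycleDl !addr0. Qed.

Lemma cocycleZl a u w : c (a *: u) w = a * c u w.
Proof. by case: cc => _ lin _ _; have /= := lin w a u 0; rewrite cocycle0l !addr0. Qed.

Lemma cocycleC u v : c u v = c v u.
Proof.
have [lin _ alt _] := cc; have := alt (u + v).
have linD w x y : c w (x + y) = c w x + c w y by have := lin w 1 x y; rewrite scale1r mul1r.
rewrite cocycleDl !linD !alt add0r addr0 => /eqP.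
by rewrite addr_eq0 (oppr_pchar2 charK2) => /eqP.
Qed.

Lemma cocycleDr u v w : c w (u + v) = c w u + c w v.
Proof. by rewrite ![c w _]cocycleC cocycleDl. Qed.

Lemma cocycleZr a u w : c w (a *: u) = a * c w u.
Proof. by rewrite ![c w _]cocycleC cocycleZl. Qed.

Lemma cocycle_suml (I : Type) (r : seq I) (F : I -> L) w :
  c (\sum_(i <- r) F i) w = \sum_(i <- r) c (F i) w.
Proof.
elim: r => [|i r IH]; first by rewrite !big_nil cocycle0l.
by rewrite !big_cons cocycleDl IH.
Qed.

Lemma cocycle_jacobi u v w : c (br u v) w = c u (br v w) + c v (br w u).
Proof.
have [_ _ _ /(_ u v w) j] := cc; rewrite [c u _]cocycleC [c v _]cocycleC.
by apply/eqP; rewrite -subr_eq0 (oppr_pchar2 charK2) addrA j.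
Qed.

Lemma cocycle_add_coboundary (f : L -> K^o) : scalar f ->
  lie_cocycle (fun u v => c u v + f (br u v)).
Proof.
move=> flin; have fD u v : f (u + v) = f u + f v.
  by have := flin 1 u v; rewrite scale1r mul1r.
have f0 : f 0 = 0 by apply: (addrI (f 0)); rewrite -fD !addr0.
have [cr cl alt jac] := cc; split=> [v a x y|v a x y|u|u v w] /=.
- by rewrite cr brDr brZr flin mulrDr addrACA.
- by rewrite (cl v) brDl brZl flin mulrDr addrACA.
- by rewrite alt (br_alt (lieP L)) f0 addr0.
- rewrite -[RHS](addr0 0) -{1}(jac u v w) -f0 -(br_jacobi (lieP L) u v w).
  rewrite !fD [br (br u v) w]brC2 // [br (br v w) u]brC2 // [br (br w u) v]brC2 //.
  rewrite [X in X + _ = _]addrACA [LHS]addrACA; congr (_ + _).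
  by rewrite -addrA addrC.
Qed.

End Cocycle.
End LieCocycles.

(** * Lie derivations and Lie cocycles of the model *)

Section ModelCohomology.
Variables (n : nat) (U : 'M[int]_n) (roots : seq 'rV[int]_n).
Hypothesis qpos : posdef U.
Hypothesis rootsE : forall v, (v \in roots) = is_root U v.
Hypothesis diagU : forall i, U i i = 1.
Hypothesis offdiagU : forall i j, i != j -> (U + U^T) i j <= 0.
Variable inv : 'M[int]_n.
Hypothesis inv_cartan : inv *m (U + U^T) = 1%:M.
Variables (K : fieldType) (charK2 : 2%N \in [pchar K]) (p : 'I_n -> bool).
Implicit Types v w : 'rV[int]_n.

Local Notation lform := (lform U).
Local Notation is_root := (is_root U).
Local Notation M := (model_lie qpos rootsE charK2 p).
Local Notation simple j := (delta_mx 0 j : 'rV[int]_n).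
Local Notation hvec := (hvec roots).
Local Notation rvec := (rvec roots K).
Local Notation mbr := (mbr U).
Local Notation gen := (model_gen qpos rootsE charK2 p).
Implicit Types (x y z : M) (r : seq_sub roots).

(* Acts on [rvec v] by the j-th coordinate of v modulo 2. *)
Definition torus j : M := coroot roots K (row j inv).

Lemma lform_inv j v : lform (row j inv) v = v 0 j.
Proof. by rewrite lformE -row_mul inv_cartan -row_mul mul1mx !mxE. Qed.

Lemma mbr_torus j v : mbr (torus j) (rvec v) = (v 0 j)%:~R *: rvec v.
Proof. by rewrite mbr_hvec_rvec // eigen_coroot lform_inv. Qed.

Lemma mbr_torus_coef j x b : mbr (torus j) x b = (degree b 0 j)%:~R * x b.
Proof.
elim/(model_ind rootsE): x => [x y IHx IHy|c x IH|a|v rv].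
- by rewrite mbrDr !ffunE IHx IHy mulrDr.
- by rewrite mbrZr !ffunE IH [LHS]mulrCA.
- by rewrite mbr_hvec !ffunE; case: b => [i|r] /=; rewrite ?mxE ?mul0r ?mulr0.
- rewrite mbr_torus !ffunE; case: b => [i|r] /=; rewrite ?mulr0 ?scaler0 //.
  by case: eqP => [->|]; rewrite ?mulr0 ?scaler0.
Qed.

(** With C the Cartan matrix, this is a = (a C) C^(-1) modulo 2. It also shows that the simple roots
    separate h. *)
Lemma torus_span (a : 'rV[K]_n) : hvec a = \sum_j eigen U a (simple j) *: torus j.
Proof.
have inv_cartan' : map_mx intr (U + U^T) *m map_mx intr inv = 1%:M :> 'M[K]_n.
  by rewrite -map_mxM (mulmx1C inv_cartan) map_mx1.
have eigenE j : eigen U a (simple j) = (a *m map_mx intr (U + U^T)) 0 j.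
  by rewrite [RHS]mxE; apply: eq_bigr => i _; rewrite lform_simple [in RHS]mxE.
have -> : \sum_j eigen U a (simple j) *: torus j =
    hvec (\sum_j eigen U a (simple j) *: row j (map_mx intr inv)).
  elim/big_rec2: _ => [|j x y _ ->].
    by apply/ffunP => -[i|r]; rewrite !ffunE ?mxE.
  by rewrite hvecD hvecZ /torus /coroot map_row.
congr hvec; rewrite (eq_bigr _ (fun j _ => congr1 ( *:%R^~ _) (eigenE j))).
rewrite -[a in LHS]mulmx1 -inv_cartan' mulmxA; apply/rowP => k; rewrite summxE mxE.
by apply: eq_bigr => j _; rewrite !mxE.
Qed.

Lemma no_cartan_part x : (forall r, x (inr r) = 0) -> exists a, x = hvec a.
Proof.
by move=> x0; exists (\row_j x (inl j)); apply/ffunP => -[j|r]; rewrite !ffunE ?mxE.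
Qed.

Lemma hvec_inj_eigen (a : 'rV[K]_n) : (forall j, eigen U a (simple j) = 0) -> hvec a = 0.
Proof. by move=> a0; rewrite torus_span big1 // => j _; rewrite a0 scale0r. Qed.

(** Simple roots must split too, which [root_reduction] does not provide. Were all (a_j, v) even,
    the coordinates of v, which are integral combinations of them by [inv], would be even. An odd
    product is 1 or -1, and the simple root of that sign can be subtracted. *)
Lemma root_split v : is_root v -> exists w w',
  [/\ is_root w, is_root w' & v = w + w'].
Proof.
move=> rv; have [j vj] : exists j, odd `|lform (simple j) v|%N.
  have [k vk] := root_odd rv; apply/existsP; apply: contraLR vk => /existsPn even_v.
  rewrite -lform_inv lform_coord.
  elim/big_ind: _ => [//|x y|i _]; first by lia.
  by have := even_v i; move: (lform (simple i) v) (row k inv 0 i) => x y;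
    rewrite abszM oddM => /negPf ->; rewrite andbF.
have rj : is_root (simple j) by exact: root_simple.
pose b := if 0 < lform (simple j) v then simple j else - simple j.
have rb : is_root b by rewrite /b; case: ifP; rewrite ?is_rootN.
have fb : lform v b = 1.
  have f1 := root_form_le qpos rj rv; have f2 := root_form_ge qpos rj rv.
  rewrite lformC /b; case: ifP; rewrite ?lformNl; move: vj f1 f2.
    by move: (lform _ v) => f; lia.
  by move: (lform _ v) => f; lia.
exists b, (v - b); split=> //; last by rewrite addrC subrK.
by rewrite root_add ?is_rootN // lformNr fb.
Qed.

Lemma root_ssval (r : seq_sub roots) : is_root (ssval r).
Proof. by rewrite -rootsE ssvalP. Qed.

(** Selects an element of the torus that acts on the given root vector as 1. *)
Definition odd_coord (r : seq_sub roots) : 'I_n := xchoose (root_odd (root_ssval r)).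

Lemma odd_coordP r : ((ssval r 0 (odd_coord r))%:~R : K) = 1.
Proof. by rewrite (int_pchar2 charK2) (xchooseP (root_odd (root_ssval r))). Qed.

Lemma natb_eq0 (b : bool) : (b%:R == 0 :> K) = ~~ b.
Proof. by case: b; rewrite ?oner_eq0 ?eqxx. Qed.

Lemma addr_eq0_pchar2 (a b : K) : a + b = 0 -> a = b.
Proof. by move/eqP; rewrite addr_eq0 (oppr_pchar2 charK2) => /eqP. Qed.

Section Derivations.
Variables (D : M -> M) (derD : lie_derivation D).

Let DD x y : D (x + y) = D x + D y.
Proof. by have := derD.1 1 x y; rewrite !scale1r. Qed.

Let D0 : D 0 = 0. Proof. by apply: (addrI (D 0)); rewrite -DD !addr0. Qed.

Let DZ a x : D (a *: x) = a *: D x.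
Proof. by rewrite -[a *: x]addr0 derD.1 D0 addr0. Qed.

Let Dbr x y : D (mbr x y) = mbr (D x) y + mbr x (D y).
Proof. exact: derD.2. Qed.

(** Applying D to [t_i, t_j] = 0 gives r_i D(t_j)_r = r_j D(t_i)_r; take j with r_j odd. Thus the
    root part of D on h is that of an inner derivation. *)
Lemma derivation_torus_coef i r :
  D (torus i) (inr r) = (ssval r 0 i)%:~R * D (torus (odd_coord r)) (inr r).
Proof.
have := Dbr (torus i) (torus (odd_coord r)); rewrite mbr_hvec D0 => /ffunP /(_ (inr r)).
rewrite !ffunE [mbr (D _) _](mbrC U charK2) !mbr_torus_coef /= odd_coordP mul1r => /esym.
exact: addr_eq0_pchar2.
Qed.

Hypothesis D_torus : forall i r, D (torus i) (inr r) = 0.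

Lemma derivation_rvec_coef v i b : is_root v ->
  ((v 0 i)%:~R + (degree b 0 i)%:~R) * D (rvec v) b = mbr (D (torus i)) (rvec v) b.
Proof.
move=> rv; have := Dbr (torus i) (rvec v); rewrite mbr_torus DZ => /ffunP /(_ b).
rewrite !ffunE mbr_torus_coef => e; rewrite mulrDl (e : _ * _ = _).
by rewrite -addrA (addrr_pchar2 charK2) addr0.
Qed.

(** By [D_torus], D t_i lies in h. In D [t_i, x_v] compare the coefficients of x_v for simple v: the
    eigenvalues of t_i cancel, leaving v(D t_i) = 0, and the simple roots separate h. *)
Lemma derivation_torus i : D (torus i) = 0.
Proof.
have [a Da] := no_cartan_part (D_torus i).
rewrite Da; apply: hvec_inj_eigen => j; have rj := root_simple diagU j.
have rj' : simple j \in roots by rewrite rootsE.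
have := derivation_rvec_coef i (inr (SeqSub rj')) rj.
rewrite Da mbr_hvec_rvec // !ffunE /= eqxx (addrr_pchar2 charK2) mul0r => /esym.
by rewrite [_ *: _]mulr1.
Qed.

Lemma derivation_hvec a : D (hvec a) = 0.
Proof.
rewrite torus_span (big_morph D DD D0) big1 // => j _.
by rewrite DZ derivation_torus scaler0.
Qed.

Lemma derivation_rvec_pm v : is_root v -> exists a b, D (rvec v)
  = a *: rvec v + b *: rvec (- v).
Proof.
move=> rv; have rv1 : v \in roots by rewrite rootsE.
have rv2 : - v \in roots by rewrite rootsE is_rootN.
exists (D (rvec v) (inr (SeqSub rv1))), (D (rvec v) (inr (SeqSub rv2))).
have coef0 b : D (rvec v) b != 0 -> forall i, odd `|v 0%R i|%N = odd `|degree b 0%R i|%N.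
  move=> Db i; have := derivation_rvec_coef i b rv.
  rewrite derivation_torus mbr0l [RHS]ffunE => /eqP; rewrite mulf_eq0 (negPf Db) orbF.
  by rewrite !int_pchar2 // natb_addb // natb_eq0 negb_add => /eqP ->.
have vNv : v == - v = false.
  by apply/negP; rewrite (root_eq qpos) ?is_rootN // lformNr (root_diag rv).
apply/ffunP => -[j|r]; rewrite !ffunE ?[_ *: _]mulr0 ?addr0.
  have [k vk] := root_odd rv; apply/eqP; apply: contraT => /coef0 /(_ k).
  by rewrite vk mxE.
case: (v =P _) => [vr|vr].
  rewrite -vr eq_sym vNv [_ *: 1]mulr1 [_ *: _]mulr0 addr0; congr (D _ (inr _)); exact: val_inj.
case: (- v =P _) => [vr'|vr'].
  rewrite [_ *: 1]mulr1 [_ *: _]mulr0 add0r; congr (D _ (inr _)); exact: val_inj.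
rewrite ![_ *: _]mulr0 addr0; apply/eqP; apply: contraT => /coef0 vr2.
by case: (root_mod2 qpos rv (root_ssval r) vr2) => [/esym|/esym].
Qed.

(* [x_(-w), x_w'] = 0 when w + w' is a root, so the x_(-v)-component of D x_v vanishes
   for v = w + w'. *)
Lemma derivation_rvec v : is_root v -> exists a, D (rvec v) = a *: rvec v.
Proof.
move=> rv; have [w [w' [rw rw' vE]]] := root_split rv.
have [a [b Dw]] := derivation_rvec_pm rw; have [a' [b' Dw']] := derivation_rvec_pm rw'.
have f : lform w w' = -1 by move: rv; rewrite vE root_add // => /eqP.
have cross u u' : is_root u -> is_root u' -> lform u u' = 1 -> mbr (rvec u) (rvec u') = 0.
  move=> ru ru' uu'; rewrite mbr_rvec // (root_opp qpos) // uu' scale0r addr0.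
  by rewrite (rvec_nroot rootsE) // root_add // uu'.
exists (a + a'); rewrite vE (rvecD rootsE) // -?vE // Dbr Dw Dw' !(mbrDl, mbrDr) !(mbrZl,
  mbrZr).
rewrite (cross (- w)) ?is_rootN // ?lformNl ?f ?opprK //.
rewrite (cross w (- w')) ?is_rootN // ?lformNr ?f ?opprK //.
by rewrite !scaler0 !addr0 scalerDl.
Qed.

End Derivations.

Lemma model_derivation_inner (D : M -> M) : lie_derivation D -> exists z, forall x, D x
  = br z x.
Proof.
move=> derD.
(* [z1, t_i] has at r the coefficient r_i z1_r, which by [derivation_torus_coef] is that of D t_i;
   adding [br z1] clears the root part. *)
pose z1 : M := [ffun b => if b is inr r then D (torus (odd_coord r)) (inr r) else 0].
pose D1 x : M := D x + br z1 x.
have derD1 : lie_derivation D1 by exact: lie_derivation_subr.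
have D1_torus i r : D1 (torus i) (inr r) = 0.
  rewrite /D1 ffunE derivation_torus_coef //.
  have -> : br z1 (torus i) = mbr (torus i) z1 by exact: (mbrC U charK2).
  by rewrite mbr_torus_coef ffunE /= (addrr_pchar2 charK2).
have D1X j : exists a, D1 (rvec (simple j)) = a *: rvec (simple j).
  by apply: derivation_rvec; rewrite ?root_simple.
have [a D1a] := fin_all_exists D1X.
(* The t_j are dual to the simple roots, so [h, x_j] = a_j x_j. *)
pose h : M := \sum_j a j *: torus j.
have h_hvec b : br h (hvec b) = 0.
  by rewrite /h br_suml big1 // => j _; rewrite brZl [br _ _]mbr_hvec scaler0.
have h_rvec j : br h (rvec (simple j)) = a j *: rvec (simple j).
  rewrite /h br_suml (bigD1 j) // big1 => [|i /andP[_ ij]];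
    rewrite brZl [br _ _]mbr_torus mxE eqxx.
    rewrite eqxx scale1r; exact: addr0.
  by rewrite (negPf ij) scale0r scaler0.
pose D2 x : M := D1 x + br h x.
have derD2 : lie_derivation D2 by exact: lie_derivation_subr.
have D2_hvec b : D2 (hvec b) = 0.
  by rewrite /D2 h_hvec addr0 derivation_hvec.
have D2_torus i r : D2 (torus i) (inr r) = 0 by rewrite D2_hvec ffunE.
have D2X j : D2 (gen (X j)) = 0 by rewrite /D2 h_rvec D1a addvv2.
(* If D2 y_j = b y_j, then D2 [x_j, y_j] = 0 reads b h_j = 0. *)
have D2Y j : D2 (gen (Y j)) = 0.
  have [b Db] : exists b, D2 (rvec (- simple j)) = b *: rvec (- simple j).
    by apply: derivation_rvec; rewrite ?is_rootN ?root_simple.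
  have := derD2.2 (gen (X j)) (gen (Y j)).
  rewrite (rel_xy (model_relations qpos rootsE diagU offdiagU charK2 p)) eqxx D2_hvec D2X
    br0l add0r.
  rewrite /= Db mbrZr.
  have -> : mbr (rvec (simple j)) (rvec (- simple j)) = hvec (delta_mx 0 j).
    have := rel_xy (model_relations qpos rootsE diagU offdiagU charK2 p) j j.
    by rewrite eqxx.
  move=> /ffunP /(_ (inl j)); rewrite !ffunE mxE !eqxx [_ *: _]mulr1 => <-.
  by rewrite scale0r.
have D2D x y : D2 (x + y) = D2 x + D2 y by have := derD2.1 1 x y; rewrite !scale1r.
have D20 : D2 0 = 0 by apply: (addrI (D2 0)); rewrite -D2D !addr0.
have D2_0 x : D2 x = 0.
  move: x; apply: (model_gen_ind diagU offdiagU) => [|x y Dx Dy|c x Dx|x y Dx Dy|j|j] //.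
  - by rewrite D2D Dx Dy addr0.
  - by rewrite -[c *: x]addr0 derD2.1 D20 Dx scaler0 addr0.
  - by rewrite derD2.2 Dx Dy br0l br0r addr0.
exists (z1 + h) => x; rewrite brDl; apply/eqP.
by rewrite -subr_eq0 (oppv2 charK2) addrA; apply/eqP/D2_0.
Qed.

Section Cocycles.
Variables (c : M -> M -> K^o) (cc : lie_cocycle c).

Let torus_rvec i j v :
  (v 0 j)%:~R * c (torus i) (rvec v) = (v 0 i)%:~R * c (torus j) (rvec v).
Proof.
have := cocycle_jacobi charK2 cc (torus i) (torus j) (rvec v).
rewrite [@br K M (torus i) _]mbr_hvec cocycle0l // [@br K M (rvec v) _](mbrC U charK2).
rewrite [@br K M _ (rvec v)]mbr_torus mbr_torus !cocycleZr // => /esym.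
exact: addr_eq0_pchar2.
Qed.

(** Thus c(t_i, x_r) depends on i only through [t_i, x_r] = r_i x_r, as for a coboundary. *)
Lemma cocycle_torus_rvec i r : c (torus i) (rvec (ssval r)) =
  (ssval r 0 i)%:~R * c (torus (odd_coord r)) (rvec (ssval r)).
Proof. by rewrite -torus_rvec odd_coordP mul1r. Qed.

Hypothesis c_torus_rvec : forall i r, c (torus i) (rvec (ssval r)) = 0.

Lemma cocycle_hvec_rvec a v : c (hvec a) (rvec v) = 0.
Proof.
case: (boolP (is_root v)) => [rv|/(rvec_nroot rootsE) ->];
  last by rewrite (cocycleC charK2 cc) cocycle0l.
have rv' : v \in roots by rewrite rootsE.
rewrite torus_span cocycle_suml // big1 // => j _.
by rewrite cocycleZl // (c_torus_rvec j (SeqSub rv')) mulr0.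
Qed.

Let torus_rvec_rvec i v w :
  ((v 0 i)%:~R + (w 0 i)%:~R) * c (rvec v) (rvec w) = c (torus i) (mbr (rvec v) (rvec w)).
Proof.
have := cocycle_jacobi charK2 cc (rvec v) (rvec w) (torus i).
rewrite (cocycleC charK2 cc) => ->; rewrite [@br K M (rvec w) _](mbrC U charK2) [@br K M
  (torus i) _]mbr_torus mbr_torus.
by rewrite !cocycleZr // [c (rvec w) _](cocycleC charK2 cc) mulrDl addrC.
Qed.

(** Here [x_v, x_w] is a multiple of a root vector, on which c(t_i, -) is zero; a nonzero c(x_v,
    x_w) would make v and w congruent modulo 2. Then w = v, excluded since c is alternating, or w =
    -v, excluded by hypothesis. *)
Lemma cocycle_rvec v w : is_root v -> is_root w -> v + w != 0 -> c (rvec v) (rvec w) = 0.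
Proof.
move=> rv rw vw; apply/eqP; apply: contraT => cvw.
have [|wv|wv] := root_mod2 qpos rv rw; last by rewrite wv subrr eqxx in vw.
  move=> k; have := torus_rvec_rvec k v w.
  rewrite mbr_rvec // (negPf vw) scale0r addr0 cocycle_hvec_rvec => /eqP.
  by rewrite mulf_eq0 (negPf cvw) orbF !int_pchar2 // natb_addb // natb_eq0 negb_add => /eqP ->.
by move: cvw; rewrite wv; case: cc => _ _ -> _; rewrite eqxx.
Qed.

Hypothesis c_simple : forall j, c (gen (X j)) (gen (Y j)) = 0.

(** The radical of a cocycle is a subalgebra, so it suffices that it contains the x_j and y_j.
    Vanishing on pairs from h is then a consequence of h_j = [x_j, y_j]. *)
Lemma cocycle_trivial x y : c x y = 0.
Proof.
have gen0 v j : (v = simple j \/ v = - simple j) -> forall z, c (rvec v) z = 0.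
  move=> vj; have rv : is_root v by case: vj => ->; rewrite ?is_rootN root_simple.
  apply: (model_ind rootsE) => [z z' cz cz'|a z cz|a|w rw].
  - by rewrite cocycleDr // cz cz' addr0.
  - by rewrite cocycleZr // cz mulr0.
  - by rewrite (cocycleC charK2 cc) cocycle_hvec_rvec.
  case: (eqVneq (v + w) 0) => [vw|]; last exact: cocycle_rvec.
  have -> : w = - v by apply/eqP; rewrite -addr_eq0 addrC vw.
  case: vj => ->; first exact: c_simple.
  by rewrite opprK (cocycleC charK2 cc); exact: c_simple.
move: x y; apply: (model_gen_ind diagU offdiagU) => [y|x x' cx cx' y|a x cx y|x x' cx cx'
  y|j y|j y].
- exact: cocycle0l.
- by rewrite cocycleDl // cx cx' addr0.
- by rewrite cocycleZl // cx mulr0.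
- by rewrite cocycle_jacobi // cx cx' addr0.
- by apply: gen0; left.
- by apply: gen0; right.
Qed.

End Cocycles.

Lemma model_cocycle_coboundary (c : M -> M -> K^o) : lie_cocycle c ->
  exists2 f : M -> K^o, scalar f & forall x y, c x y = f (br x y).
Proof.
move=> cc.
pose f1 (x : M) : K^o := \sum_r x (inr r) * c (torus (odd_coord r)) (rvec (ssval r)).
have f1_lin : scalar f1.
  move=> a x y; rewrite mulr_sumr -big_split; apply: eq_bigr => r _.
  by rewrite !ffunE mulrDl mulrA.
pose c1 x y := c x y + f1 (br x y).
have cc1 : lie_cocycle c1 by exact: cocycle_add_coboundary.
have f1_rvec r : f1 (rvec (ssval r)) = c (torus (odd_coord r)) (rvec (ssval r)).
  rewrite /f1 (bigD1 r) //= big1 => [|s sr]; rewrite ffunE ?eqxx ?mul1r ?addr0 //.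
  by rewrite (inj_eq val_inj) eq_sym (negPf sr) mul0r.
have f1_0 : f1 0 = 0 by rewrite /f1 big1 // => r _; rewrite ffunE mul0r.
have c1_torus i r : c1 (torus i) (rvec (ssval r)) = 0.
  rewrite /c1 [@br K M _ _]mbr_torus cocycle_torus_rvec //.
  by rewrite -[_ *: _]addr0 f1_lin f1_0 addr0 f1_rvec (addrr_pchar2 charK2).
(* Supported on h, hence zero on [t_i, x_r]: the values normalised by [f1] stay zero. *)
pose f2 (x : M) : K^o := \sum_j x (inl j) * c1 (gen (X j)) (gen (Y j)).
have f2_lin : scalar f2.
  move=> a x y; rewrite mulr_sumr -big_split; apply: eq_bigr => r _.
  by rewrite !ffunE mulrDl mulrA.
pose c2 x y := c1 x y + f2 (br x y).
have cc2 : lie_cocycle c2 by exact: cocycle_add_coboundary.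
have c2_0 : forall x y, c2 x y = 0.
  apply: cocycle_trivial => // [i r|j].
    rewrite /c2 c1_torus add0r [@br K M _ _]mbr_torus /f2 big1 // => j _.
    by rewrite !ffunE scaler0 mul0r.
  rewrite /c2 (rel_xy (model_relations qpos rootsE diagU offdiagU charK2 p)) eqxx /f2.
  rewrite (bigD1 j) //= big1 => [|i ij]; rewrite ffunE mxE eqxx.
    by rewrite eqxx mul1r addr0 (addrr_pchar2 charK2).
  by rewrite (negPf ij) mul0r.
exists (fun x => f1 x + f2 x) => [a x y|x y]; first by rewrite f1_lin f2_lin mulrDr addrACA.
apply/eqP; rewrite -subr_eq0 (oppr_pchar2 charK2) addrA.
by apply/eqP/c2_0.
Qed.

End ModelCohomology.

(** * Transport along a linear bijection preserving brackets *)

Section Transport.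
Variables (K : fieldType) (L L' : lieSuper K) (phi : L -> L').
Hypothesis phi_linear : linear phi.
Hypothesis phi_br : forall u v, phi (br u v) = br (phi u) (phi v).
Hypothesis phi_inj : injective phi.
Hypothesis phi_surj : forall x, exists u, phi u = x.

Lemma linear_inverse : exists2 psi : L' -> L, linear psi & cancel psi phi.
Proof.
have ex x : exists u, phi u == x by have [u <-] := phi_surj x; exists u.
exists (fun x => xchoose (ex x)) => [a x y|x]; last exact/eqP/(xchooseP (ex x)).
apply: phi_inj; rewrite phi_linear.
by rewrite !(eqP (xchooseP (ex _))).
Qed.

Lemma transport_derivation_inner :
  (forall D : L' -> L', lie_derivation D -> exists z, forall x, D x = br z x) ->
  forall D : L -> L, lie_derivation D -> exists z, forall u, D u = br z u.
Proof.
move=> inner D [Dlin Dbr]; have [psi psi_lin psiK] := linear_inverse.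
have phiK u : psi (phi u) = u by apply: phi_inj; rewrite psiK.
have [|z zD] := inner (fun x => phi (D (psi x))).
  split=> [a x y|x y]; first by rewrite psi_lin Dlin phi_linear.
  have -> : psi (br x y) = br (psi x) (psi y) by apply: phi_inj; rewrite phi_br !psiK.
  have phiD u v : phi (u + v) = phi u + phi v.
    by have := phi_linear 1 u v; rewrite !scale1r.
  by rewrite Dbr phiD !phi_br !psiK.
exists (psi z) => u; apply: phi_inj.
by rewrite phi_br psiK -zD phiK.
Qed.

Lemma transport_cocycle_coboundary :
  (forall c : L' -> L' -> K^o, lie_cocycle c ->
     exists2 f : L' -> K^o, scalar f & forall x y, c x y = f (br x y)) ->
  forall c : L -> L -> K^o, lie_cocycle c ->
     exists2 f : L -> K^o, scalar f & forall u v, c u v = f (br u v).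
Proof.
move=> cob c [cr cl alt jac]; have [psi psi_lin psiK] := linear_inverse.
have phiK u : psi (phi u) = u by apply: phi_inj; rewrite psiK.
have psi_br x y : psi (br x y) = br (psi x) (psi y).
  by apply: phi_inj; rewrite phi_br !psiK.
have [|f flin cf] := cob (fun x y => c (psi x) (psi y)).
  split=> [x a y y'|x a y y'|x|x y w] /=; rewrite ?psi_lin ?cr ?psi_br //.
  exact: cl.
exists (f \o phi) => [a u v|u v] /=; first by rewrite phi_linear flin.
by rewrite phi_br -cf !phiK.
Qed.

End Transport.

(** * Quadratic components and dual bases *)

Section SecondCohomology.
Variables (K : fieldType) (charK2 : 2%N \in [pchar K]) (L : lieSuper K).

Lemma coboundary2_of (f : L -> K^o) : scalar f ->
  coboundary2 ((fun u v => f (br u v), fun u => f (sq u)) : cochain2 L).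
Proof.
move=> flin; pose F : {scalar L} := HB.pack f (GRing.isLinear.Build K L K^o *%R f flin).
by exists F.
Qed.

Lemma cocycle2_lie_cocycle (z : cochain2 L) : cocycle2 z -> lie_cocycle z.1.
Proof. by case=> -[cr cl] alt _ jac _; split. Qed.

Lemma coboundary2_cocycle2 (z : cochain2 L) : coboundary2 z -> cocycle2 z.
Proof.
move=> [f ->]; split=> /=.
- split=> [v a x y|v a x y]; first by rewrite brDr brZr linearD linearZ.
  by rewrite brDl brZl linearD linearZ.
- by move=> u; rewrite (br_alt (lieP L)) linear0.
- split=> [u|a u|u v uo vo]; first by rewrite (sq_od (lieP L)).
  + by rewrite (sq_scale (lieP L)) linearZ.
  + by rewrite -!linearB -(sq_polar (lieP L)) (uo : od u = u) (vo : od v = v).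
- move=> u v w; rewrite -!linearD -[RHS](linear0 f) -(br_jacobi (lieP L) u v w); congr (f _).
  rewrite ![br (br _ _) _](brC2 charK2).
  by rewrite -addrA addrC.
- by move=> u v uo; rewrite (br_sq (lieP L)) (uo : od u = u).
Qed.

Lemma cocycle2_0 : cocycle2 (0 : cochain2 L).
Proof.
split=> /=.
- by split=> [v a x y|v a x y]; rewrite /= mulr0 addr0.
- by [].
- by split=> [//|a u|u v _ _]; rewrite /= ?mulr0 ?subr0.
- by move=> u v w; rewrite /= !addr0.
- by [].
Qed.

Lemma cocycle2D (z z' : cochain2 L) : cocycle2 z -> cocycle2 z' -> cocycle2 (z + z').
Proof.
move=> [[cr cl] alt [qo qs qp] jac csq] [[cr' cl'] alt' [qo' qs' qp'] jac' csq'].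
suff : cocycle2 ((fun u v => z.1 u v + z'.1 u v, fun u => z.2 u + z'.2 u) : cochain2 L) by [].
split=> /=.
- split=> [v a x y|v a x y] /=; first by rewrite cr cr' mulrDr addrACA.
  by rewrite (cl v) (cl' v) mulrDr addrACA.
- by move=> u; rewrite /= alt alt' addr0.
- split=> [u|a u|u v uo vo] /=; first by rewrite qo qo'.
  + by rewrite qs qs' mulrDr.
  + by rewrite -qp // -qp' // [RHS]addrACA -opprD (addrACA (z.2 (u + v))) -opprD.
- move=> u v w /=; rewrite -[RHS](addr0 0) -{1}(jac u v w) -(jac' u v w).
  by rewrite [RHS]addrACA; congr (_ + _); rewrite [RHS]addrACA.
- by move=> u v uo /=; rewrite csq // csq'.
Qed.

Lemma cocycle2Z a (z : cochain2 L) : cocycle2 z -> cocycle2 (a *: z).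
Proof.
move=> [[cr cl] alt [qo qs qp] jac csq].
suff : cocycle2 ((fun u v => a * z.1 u v, fun u => a * z.2 u) : cochain2 L) by [].
split=> /=.
- split=> [v b x y|v b x y] /=; first by rewrite cr mulrDr mulrCA.
  by rewrite (cl v) mulrDr mulrCA.
- by move=> u; rewrite /= alt mulr0.
- split=> [u|b u|u v uo vo] /=; first by rewrite qo.
  + by rewrite qs [LHS]mulrCA.
  + by rewrite -qp // !mulrBr.
- by move=> u v w /=; rewrite -!scalerDr jac scaler0.
- by move=> u v uo /=; rewrite csq.
Qed.

(** Frobenius makes the square of a linear form additive, so its polar form is 0. *)
Lemma wedge_square_cocycle2 (alpha : {scalar L}) : cocycle2 (wedge_square alpha).
Proof.
split=> /=.
- by split=> [v a x y|v a x y]; rewrite /= mulr0 addr0.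
- by [].
- split=> [u|a u|u v uo vo] /=; first by rewrite (od_idem (lieP L)).
  + by rewrite odZ linearZ exprMn.
  + rewrite odD linearD -!(Frobenius_autE charK2).
    by rewrite rmorphD addrAC !addrK subrr.
- by move=> u v w; rewrite /= !addr0.
- by [].
Qed.

Hypothesis coboundary : forall c : L -> L -> K^o, lie_cocycle c ->
  exists2 f : L -> K^o, scalar f & forall u v, c u v = f (br u v).

Lemma even_H2_zero : (forall v : L, od v = 0) -> H2_zero L.
Proof.
move=> od_eq0 z; split=> [cz|]; last exact: coboundary2_cocycle2.
have [f flin cf] := coboundary (cocycle2_lie_cocycle cz).
have [_ _ [qo qs _] _ _] := cz.
have -> : z = (fun u v => f (br u v), fun u => f (sq u)); last exact: coboundary2_of.
have f0 : f 0 = 0.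
  apply: (addrI (f 0)); rewrite addr0.
  by have := flin 1 0 0; rewrite scale1r mul1r addr0 => <-.
case: z cf qo qs {cz} => c q /= cf qo qs; congr pair; apply: funext => u.
  by apply: funext => v; exact: cf.
rewrite -qo od_eq0 sq_even // f0 -(scale0r (0 : L)) qs expr0n; exact: mul0r.
Qed.

Lemma square_expansion (B : eqType) (b : B -> L) (hat : B -> {scalar L}) (s : seq B)
    (q : L -> K^o) :
  (forall u, u = \sum_(k <- s) hat k u *: b k) ->
  (forall u v, q (u + v) = q u + q v) -> (forall a u, q (a *: u) = a ^+ 2 * q u) ->
  forall u, q u = \sum_(k <- s) q (b k) * hat k u ^+ 2.
Proof.
move=> exp qD qZ u.
have q0 : q 0 = 0 by rewrite -(scale0r (0 : L)) qZ expr0n mul0r.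
rewrite [in LHS](exp u) (big_morph q qD q0); apply: eq_bigr => k _.
by rewrite qZ mulrC.
Qed.

Lemma sum_wedge_squares (B : eqType) (s : seq B) (a : B -> K) (alpha : B -> {scalar L}) :
  \sum_(k <- s) a k *: (wedge_square (alpha k) : cochain2 L) =
    ((fun _ _ => 0, fun u => \sum_(k <- s) a k * alpha k (od u) ^+ 2) : cochain2 L).
Proof.
elim: s => [|k s IH].
  by rewrite big_nil; congr pair; apply: funext => u; rewrite big_nil.
rewrite big_cons IH; congr pair; apply: funext => u /=.
  by apply: funext => v; apply: (@etrans _ _ (a k * 0 + 0)); rewrite // mulr0 addr0.
by rewrite big_cons.
Qed.

Lemma in_span_sum (S : cochain2 L -> Prop) (B : eqType) (s : seq B) (a : B -> K)
    (w : B -> cochain2 L) : (forall k, k \in s -> S (w k)) ->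
  in_span S (\sum_(k <- s) a k *: w k).
Proof.
move=> Sw; exists (size s), (fun i => a (tnth (in_tuple s) i)), (fun i =>
  w (tnth (in_tuple s) i)).
split=> [i|]; last by rewrite big_tnth.
by apply: Sw; exact: mem_tnth.
Qed.

(** The index type is not assumed finite, and in [dual_bases] the finite sequence depends on the
    vector. Finite dimension yields one sequence for all: an index missing from the expansions of
    all [e t] would have a dual functional vanishing on L, against [hat k (b k) = 1]. *)
Lemma dual_bases_expansion (B : eqType) (b : B -> L) (hat : B -> {scalar L})
    (T : finType) (e : T -> L) : dual_bases b hat ->
  (forall u, exists a : T -> K, u = \sum_t a t *: e t) ->
  exists s : seq B, forall u, u = \sum_(k <- s) hat k u *: b k.
Proof.
move=> [hatb span] fin.
have [s es] := fin_all_exists (fun t => span (e t)).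
pose s0 := undup (flatten [seq s t | t <- enum T]).
have s0_all k : k \in s0.
  apply: contraT => ks0; have := hatb k k; rewrite eqxx.
  have [a ->] := fin (b k); rewrite linear_sum big1 => [/eqP|t _];
    first by rewrite eq_sym oner_eq0.
  have [a' ->] := es t; rewrite scalarZ linear_sum big_seq big1 ?mulr0 // => i si.
  rewrite scalarZ hatb; case: eqP => [ki|]; last by rewrite mulr0.
  move: ks0; rewrite ki mem_undup; case/negP; apply/flattenP; exists (s t) => //.
  by apply/map_f; rewrite mem_enum.
exists s0 => u; have [r [a ->]] := span u.
elim: r => [|i r IH].
  by rewrite big_nil big1 // => k _; rewrite linear0 scale0r.
rewrite big_cons [X in _ + X = _]IH.
under [RHS]eq_bigr do rewrite linearD scalerDl.
rewrite big_split /=; congr (_ + _).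
rewrite (bigD1_seq i) ?undup_uniq //= big1 => [|k ki]; rewrite scalarZ hatb.
  by rewrite eqxx addr0 mulr1.
by rewrite (negPf ki) mulr0 scale0r.
Qed.

End SecondCohomology.

(** * Cohomology of the contragredient algebra *)

Section ContragredientCohomology.
Variables (n : nat) (U : 'M[int]_n) (roots : seq 'rV[int]_n).
Hypothesis qpos : posdef U.
Hypothesis rootsE : forall v, (v \in roots) = is_root U v.
Hypothesis diagU : forall i, U i i = 1.
Hypothesis offdiagU : forall i j, i != j -> (U + U^T) i j <= 0.
Variable inv : 'M[int]_n.
Hypothesis inv_cartan : inv *m (U + U^T) = 1%:M.
Variables (K : fieldType) (charK2 : 2%N \in [pchar K]).
Variable A : 'M[K]_n.
Hypothesis AE : A = map_mx intr (U + U^T).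
Variable p : 'I_n -> bool.
Local Notation L := (contragredient A p).

Lemma contragredient_derivation_inner (D : L -> L) :
  lie_derivation D -> exists z, forall u, D u = br z u.
Proof.
move: D; rewrite AE; apply: transport_derivation_inner.
- exact: (model_of_linear qpos rootsE diagU offdiagU charK2).
- exact: model_of_br.
- exact: model_of_inj.
- exact: model_of_surj.
- by move=> D; exact: (model_derivation_inner diagU offdiagU inv_cartan).
Qed.

Lemma contragredient_cocycle_coboundary (c : L -> L -> K^o) : lie_cocycle c ->
  exists2 f : L -> K^o, scalar f & forall u v, c u v = f (br u v).
Proof.
move: c; rewrite AE; apply: transport_cocycle_coboundary.
- exact: (model_of_linear qpos rootsE diagU offdiagU charK2).
- exact: model_of_br.
- exact: model_of_inj.
- exact: model_of_surj.
- by move=> c; exact: (model_cocycle_coboundary diagU offdiagU inv_cartan).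
Qed.

Lemma contragredient_H1_zero : H1_zero L.
Proof.
move=> D [Dlin Dbr _]; have [z Dz] := contragredient_derivation_inner (conj Dlin Dbr).
by exists z; apply: funext.
Qed.

Lemma contragredient_H2_zero : (forall j, ~~ p j) -> H2_zero L.
Proof.
move=> p0; apply: (even_H2_zero charK2) => [c|]; first exact: contragredient_cocycle_coboundary.
exact: contragredient_even.
Qed.

Lemma contragredient_finite : exists (T : finType) (e : T -> L),
  forall u, exists a : T -> K, u = \sum_t a t *: e t.
Proof.
rewrite AE; have lin := @model_of_linear _ _ _ qpos rootsE diagU offdiagU _ charK2 p.
have inj := @model_of_inj _ _ _ qpos rootsE diagU offdiagU _ charK2 p.
have surj := @model_of_surj _ _ _ qpos rootsE diagU offdiagU _ charK2 p.
have [psi psi_lin psiK] := linear_inverse lin inj surj.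
have psiD x y : psi (x + y) = psi x + psi y by have := psi_lin 1 x y; rewrite !scale1r.
have psi0 : psi 0 = 0 by apply: (addrI (psi 0)); rewrite -psiD !addr0.
exists ('I_n + seq_sub roots)%type, (fun b => psi [ffun c => (c == b)%:R]) => u.
exists (model_of qpos rootsE charK2 u); apply: inj.
rewrite -[LHS]psiK; congr (model_of _ _ _ _).
set x := model_of _ _ _ u.
have {1}-> : x = \sum_b x b *: ([ffun c => (c == b)%:R] : model roots K).
  apply/ffunP => b; rewrite sum_ffunE (bigD1 b) //= big1 => [|c cb]; rewrite !ffunE.
    by rewrite eqxx addr0 [RHS]mulr1.
  by rewrite eq_sym (negPf cb) scaler0.
rewrite (big_morph psi psiD psi0); apply: eq_bigr => b _.
by rewrite -[X in psi X]addr0 psi_lin psi0 addr0.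
Qed.

Lemma contragredient_H2_span (I : eqType) (x y : I -> L)
    (hath : 'I_n -> {scalar L}) (hatx haty : I -> {scalar L}) :
  root_basis (@chevalley K n A p) x y hath hatx haty ->
  H2_is_span (odd_root_squares x y hatx haty).
Proof.
move=> [[d dP]]; set b := fun k => _; set hat := fun k => _ => dual.
have rel : cartan_relations A p (@chevalley K n A p) by rewrite AE; exact: chevalley_relations.
have x_par i : has_parity (weight_parity p (d i)) (x i).
  by have [_ _ hx _] := dP i; exact: (homogeneous_parity rel hx).
have y_par i : has_parity (weight_parity p (d i)) (y i).
  by have [_ _ _ hy] := dP i; rewrite -weight_parityN; exact: (homogeneous_parity rel hy).
move=> z; split=> [cz|[s [t [[m [a [w [Sw ->]]]] cob ->]]]]; last first.
  apply: cocycle2D; last exact: coboundary2_cocycle2.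
  elim/big_ind: _ => [||k _]; [exact: cocycle2_0 | exact: cocycle2D |].
  by apply: cocycle2Z; have [i [_ _ [|] ->]] := Sw k; exact: wedge_square_cocycle2.
have [f flin cf] := contragredient_cocycle_coboundary (cocycle2_lie_cocycle cz).
have [T [e fin]] := contragredient_finite.
have [s exp] := dual_bases_expansion dual fin.
have [_ _ [qo qs qp] _ _] := cz.
have fD u v : f (u + v) = f u + f v by have := flin 1 u v; rewrite scale1r mul1r.
have f0 : f 0 = 0 by apply: (addrI (f 0)); rewrite -fD !addr0.
have fZ c u : f (c *: u) = c * f u by rewrite -[c *: u]addr0 flin f0 addr0.
(* What is left of the cocycle after the coboundary of f is removed. The polar forms of [z.2] and of
   f composed with [sq] agree on odd parts, so q is additive. *)
pose q u := z.2 u + f (sq u).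
have q_od u : q (od u) = q u by rewrite /q qo (sq_od (lieP L)).
have qZ c u : q (c *: u) = c ^+ 2 * q u.
  by rewrite /q qs (sq_scale (lieP L)) fZ mulrDr.
have qD u v : q (u + v) = q u + q v.
  have odd_od (w : L) : is_odd (od w) by rewrite /is_odd /has_parity (od_idem (lieP L)).
  have /eqP := qp _ _ (odd_od u) (odd_od v); rewrite !subr_eq -odD !qo cf => /eqP zD.
  rewrite /q zD sqD !fD -(addrA (f _)) (addrC (f _)) addrACA (addrr_pchar2 charK2) addr0.
  by rewrite (addrC (z.2 v) (z.2 u)) addrACA.
pose odd_index (k : 'I_n + (I + I)) : bool := match k with
  inl _ => false | inr (inl i) | inr (inr i) => weight_parity p (d i) end.
have q_even k : ~~ odd_index k -> q (b k) = 0.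
  have q0 : q 0 = 0 by rewrite -(scale0r (0 : L)) qZ expr0n mul0r.
  rewrite -q_od => k_even; suff -> : od (b k) = 0 by [].
  case: k k_even => [j _|[i|i] /= /negPf k_even]; first exact: (parity_h rel).
    by have := x_par i; rewrite k_even.
  by have := y_par i; rewrite k_even.
pose w k : cochain2 L := wedge_square (hat k).
exists (\sum_(k <- [seq k <- s | odd_index k]) q (b k) *: w k),
  (fun u v => f (br u v), fun u => f (sq u)); split.
- apply: in_span_sum => -[j|[i|i]]; rewrite mem_filter //= => /andP[i_odd _]; exists i.
    by move: (x_par i) (y_par i); rewrite i_odd; split=> //; left.
  by move: (x_par i) (y_par i); rewrite i_odd; split=> //; right.
- exact: coboundary2_of.
rewrite sum_wedge_squares.
have zq u : z.2 u = q u + f (sq u) by rewrite /q -addrA (addrr_pchar2 charK2) addr0.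
case: z cf {cz qo qs qp} q zq q_od qZ qD q_even => c r /= cf q zq q_od qZ qD q_even.
congr pair; apply: funext => u.
  by apply: funext => v; rewrite cf; symmetry; exact: add0r.
rewrite zq; congr (_ + f (sq u)).
transitivity (\sum_(k <- [seq k <- s | odd_index k]) q (b k) * hat k (od u) ^+ 2); last by [].
rewrite -q_od (square_expansion exp qD qZ) big_filter [RHS]big_mkcond.
by apply: eq_bigr => k _; case: ifP => // /negbT /q_even ->; rewrite mul0r.
Qed.

End ContragredientCohomology.

(** * The lattice E8 *)

(* Only half of the Cartan matrix: the quadratic form is v U v^T and the bilinear
   form, i.e. the Cartan matrix, is U + U^T. *)
Definition E8_matrix : 'M[int]_8 := \matrix_(i, j) ((i == j)%:R - (E8_edge i.+1 j.+1)%:R).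

(* Completing the square from the ends of the three arms towards node 5. *)
Lemma E8_qform (v : 'rV[int]_8) (x := fun k : nat => v 0 (inord k)) :
  120 * qform E8_matrix v =
    30 * (2 * x 0%N - x 1%N) ^+ 2 + 10 * (3 * x 1%N - 2 * x 2%N) ^+ 2
    + 5 * (4 * x 2%N - 3 * x 3%N) ^+ 2 + 3 * (5 * x 3%N - 4 * x 4%N) ^+ 2
    + 30 * (2 * x 6%N - x 5%N) ^+ 2 + 10 * (3 * x 5%N - 2 * x 4%N) ^+ 2
    + 30 * (2 * x 7%N - x 4%N) ^+ 2 + 2 * x 4%N ^+ 2.
Proof.
have vx (j : 'I_8) : v 0 j = x j by rewrite /x inord_val.
rewrite /qform mxE.
under eq_bigr => k _.
  rewrite !mxE vx.
  under eq_bigr => j _ do rewrite !mxE vx.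
  over.
clearbody x; rewrite /= !big_ord_recl !big_ord0 /E8_edge /= /bump /=.
ring.
Qed.

Lemma E8_edge_ltn a b : E8_edge a b -> (a < b)%N.
Proof. by rewrite /E8_edge !inE !xpair_eqE; lia. Qed.

Lemma square_bound (c b m y : int) :
  0 < c -> 0 <= m -> c * y ^+ 2 <= b -> b < c * (m + 1) ^+ 2 -> - m <= y <= m.
Proof.
move=> c0 m0 yb bm; have {yb bm} : c * y ^+ 2 < c * (m + 1) ^+ 2 by exact: le_lt_trans bm.
by rewrite ltr_pM2l // -real_normK ?num_real // ltr_pXn2r ?nnegrE ?addr_ge0 //; lia.
Qed.

Lemma E8_squares_le (v : 'rV[int]_8) (x := fun k : nat => v 0 (inord k))
    (b := 120 * qform E8_matrix v) :
  [/\ [/\ 30 * (2 * x 0%N - x 1%N) ^+ 2 <= b, 10 * (3 * x 1%N - 2 * x 2%N) ^+ 2 <= b,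
        5 * (4 * x 2%N - 3 * x 3%N) ^+ 2 <= b & 3 * (5 * x 3%N - 4 * x 4%N) ^+ 2 <= b],
      [/\ 30 * (2 * x 6%N - x 5%N) ^+ 2 <= b, 10 * (3 * x 5%N - 2 * x 4%N) ^+ 2 <= b,
        30 * (2 * x 7%N - x 4%N) ^+ 2 <= b & 2 * x 4%N ^+ 2 <= b] & 0 <= b].
Proof.
rewrite /b E8_qform -/(x 0%N) -/(x 1%N) -/(x 2%N) -/(x 3%N) -/(x 4%N) -/(x 5%N) -/(x 6%N)
  -/(x 7%N).
(* Each square is replaced by a fresh nonnegative variable, which makes the inequalities linear. *)
have := sqr_ge0 (2 * x 0%N - x 1%N); move: ((2 * x 0%N - x 1%N) ^+ 2) => y0 p0.
have := sqr_ge0 (3 * x 1%N - 2 * x 2%N); move: ((3 * x 1%N - 2 * x 2%N) ^+ 2) => y1 p1.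
have := sqr_ge0 (4 * x 2%N - 3 * x 3%N); move: ((4 * x 2%N - 3 * x 3%N) ^+ 2) => y2 p2.
have := sqr_ge0 (5 * x 3%N - 4 * x 4%N); move: ((5 * x 3%N - 4 * x 4%N) ^+ 2) => y3 p3.
have := sqr_ge0 (2 * x 6%N - x 5%N); move: ((2 * x 6%N - x 5%N) ^+ 2) => y4 p4.
have := sqr_ge0 (3 * x 5%N - 2 * x 4%N); move: ((3 * x 5%N - 2 * x 4%N) ^+ 2) => y5 p5.
have := sqr_ge0 (2 * x 7%N - x 4%N); move: ((2 * x 7%N - x 4%N) ^+ 2) => y6 p6.
have := sqr_ge0 (x 4%N); move: ((x 4%N) ^+ 2) => y7 p7.
by do !split; lia.
Qed.

(** The largest coefficient of a root is 6; the cruder 7 is what the square at node 5 gives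
    directly, and it is enough for finiteness. *)
Lemma E8_coord_bound (v : 'rV[int]_8) j : is_root E8_matrix v -> - 7 <= v 0 j <= 7.
Proof.
move=> /eqP q1; have := E8_squares_le v; rewrite q1; set x := fun k : nat => v 0 (inord k).
move=> /= [[b1 b2 b3 b4] [b5 b6 b7 b8] _].
(* The bound for coefficient c is the integer part of the square root of 120 / c: 2, 3, 4, 6, 7 for
   c = 30, 10, 5, 3, 2. *)
have {}b1 := @square_bound 30 _ 2 _ isT isT b1 isT.
have {}b2 := @square_bound 10 _ 3 _ isT isT b2 isT.
have {}b3 := @square_bound 5 _ 4 _ isT isT b3 isT.
have {}b4 := @square_bound 3 _ 6 _ isT isT b4 isT.
have {}b5 := @square_bound 30 _ 2 _ isT isT b5 isT.
have {}b6 := @square_bound 10 _ 3 _ isT isT b6 isT.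
have {}b7 := @square_bound 30 _ 2 _ isT isT b7 isT.
have {}b8 := @square_bound 2 _ 7 _ isT isT b8 isT.
rewrite -/(x 0%N) -/(x 1%N) -/(x 2%N) -/(x 3%N) -/(x 4%N) -/(x 5%N) -/(x 6%N) -/(x 7%N) in
  b1 b2 b3 b4 b5 b6 b7 b8.
rewrite -[j]inord_val -/(x j); clearbody x.
by case: j => -[|[|[|[|[|[|[|[|//]]]]]]]] _ /=; lia.
Qed.

Lemma E8_posdef : posdef E8_matrix.
Proof.
move=> v; have := E8_squares_le v; set x := fun k : nat => v 0 (inord k).
move=> /= [[b1 b2 b3 b4] [b5 b6 b7 b8] q0].
rewrite pmulr_rge0 // in q0; split=> //; apply/eqP/eqP => [q00|->]; last by rewrite qform0.
move: b1 b2 b3 b4 b5 b6 b7 b8; rewrite -q00 mulr0 => b1 b2 b3 b4 b5 b6 b7 b8.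
have {}b1 := @square_bound 30 _ 0 _ isT isT b1 isT.
have {}b2 := @square_bound 10 _ 0 _ isT isT b2 isT.
have {}b3 := @square_bound 5 _ 0 _ isT isT b3 isT.
have {}b4 := @square_bound 3 _ 0 _ isT isT b4 isT.
have {}b5 := @square_bound 30 _ 0 _ isT isT b5 isT.
have {}b6 := @square_bound 10 _ 0 _ isT isT b6 isT.
have {}b7 := @square_bound 30 _ 0 _ isT isT b7 isT.
have {}b8 := @square_bound 2 _ 0 _ isT isT b8 isT.
rewrite -/(x 0%N) -/(x 1%N) -/(x 2%N) -/(x 3%N) -/(x 4%N) -/(x 5%N) -/(x 6%N) -/(x 7%N) in
  b1 b2 b3 b4 b5 b6 b7 b8.
apply/rowP => j; rewrite mxE -[j]inord_val -/(x j); clearbody x.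
by case: j => -[|[|[|[|[|[|[|[|//]]]]]]]] _ /=; lia.
Qed.

(** The box of coordinates from -7 to 7, shifted into ['I_15]. Its 15^8 vectors are never
    enumerated; only membership is reasoned about. *)
Definition E8_roots : seq 'rV[int]_8 :=
  [seq v <- [seq \row_j ((t j : nat)%:Z - 7) | t : {ffun 'I_8 -> 'I_15}] | is_root E8_matrix v].

Lemma E8_rootsE v : (v \in E8_roots) = is_root E8_matrix v.
Proof.
rewrite mem_filter; case: (boolP (is_root _ v)) => //= rv.
apply/mapP; exists [ffun j => inord (absz (v 0 j + 7))]; first by rewrite mem_enum.
apply/rowP => j; rewrite mxE ffunE inordK; have := E8_coord_bound j rv; move: (v 0 j) => z; lia.
Qed.

Lemma E8_diag i : E8_matrix i i = 1.
Proof.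
rewrite mxE eqxx; case: (boolP (E8_edge _ _)) => [/E8_edge_ltn|_]; first by rewrite ltnn.
by rewrite subr0.
Qed.

Lemma E8_offdiag i j : i != j -> (E8_matrix + E8_matrix^T) i j <= 0.
Proof.
move=> ij; rewrite !mxE [j == i]eq_sym (negPf ij).
by case: (E8_edge _ _) (E8_edge _ _) => [] [].
Qed.

(** The rows are the fundamental weights in the simple roots, integral because the lattice is
    unimodular; the first row is the highest root. *)
Definition E8_inverse : 'M[int]_8 := \matrix_(i, j)
  nth 0 (nth [::] [:: [:: 2; 3; 4; 5; 6; 4; 2; 3]; [:: 3; 6; 8; 10; 12; 8; 4; 6];
    [:: 4; 8; 12; 15; 18; 12; 6; 9]; [:: 5; 10; 15; 20; 24; 16; 8; 12];
    [:: 6; 12; 18; 24; 30; 20; 10; 15]; [:: 4; 8; 12; 16; 20; 14; 7; 10];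
    [:: 2; 4; 6; 8; 10; 7; 4; 5]; [:: 3; 6; 9; 12; 15; 10; 5; 8]] i) j.

Lemma E8_inverseK : E8_inverse *m (E8_matrix + E8_matrix^T) = 1%:M.
Proof.
apply/matrixP => i j; rewrite mxE.
under eq_bigr => k _ do rewrite !mxE.
rewrite !big_ord_recl big_ord0 mxE -!val_eqE /=.
case: i => -[|[|[|[|[|[|[|[|//]]]]]]]] _ /=; case: j => -[|[|[|[|[|[|[|[|//]]]]]]]] _ //=.
Qed.

(** Modulo 2 the diagonal entries 2 become 0 and the entries -1 become 1. *)
Lemma cartan_E8E (K : fieldType) (charK2 : 2%N \in [pchar K]) :
  cartan_E8 K = map_mx intr (E8_matrix + E8_matrix^T).
Proof.
apply/matrixP => i j; rewrite !mxE (int_pchar2 charK2) [j == i]eq_sym.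
case: (eqVneq i j) => [->|ij].
  by case: (boolP (E8_edge _ _)) => [/E8_edge_ltn|_] //; rewrite ltnn.
case: (boolP (E8_edge i.+1 _)) => [/E8_edge_ltn ij'|_]; last by case: (E8_edge _ _).
by case: (boolP (E8_edge _ _)) => [/E8_edge_ltn|_] //; rewrite ltnNge ltnW.
Qed.

Theorem lemma2p35 (K : closedFieldType) (charK2 : 2%N \in [pchar K]) :
  (H1_zero (e8 K) /\ H2_zero (e8 K)) /\
  (forall i : nat, i = 1%N \/ i = 8%N ->
     H1_zero (e8super K i) /\
     forall (I : eqType) (x y : I -> e8super K i)
       (hath : 'I_8 -> {scalar e8super K i}) (hatx haty : I -> {scalar e8super K i}),
       root_basis (@e8super_gen K i) x y hath hatx haty ->
       H2_is_span (odd_root_squares x y hatx haty)).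
Proof.
have AE := cartan_E8E charK2.
have H1 p : H1_zero (contragredient (cartan_E8 K) p).
  exact: (contragredient_H1_zero E8_posdef E8_rootsE E8_diag E8_offdiag E8_inverseK charK2 AE).
split; first split; first exact: H1.
  by apply: (contragredient_H2_zero E8_posdef E8_rootsE E8_diag E8_offdiag E8_inverseK
    charK2 AE).
move=> i _; split=> [|I x y hath hatx haty]; first exact: H1.
exact: (contragredient_H2_span E8_posdef E8_rootsE E8_diag E8_offdiag E8_inverseK charK2 AE).
Qed.
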